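(* Let $\mathbb{P}$ be generated by a PLSEM, let $F$ be the PLSEM-function of any PLSEM generating $\mathbb{P}$, and let $\mathcal{V}=\{(i,j)\in\{1,\dots,p\}^2:\ e_j^t(\mathrm{D}F)^{-1}\partial_i^2F\not\equiv 0\}$. Then $$\mathcal{S}(\mathbb{P})=\{\sigma\text{ permutation of }\{1,\dots,p\}:\ \sigma(i)<\sigma(j)\text{ for all }(i,j)\in\mathcal{V}\}.$$
   Context: A PLSEM with DAG $D$ on $\{1,\dots,p\}$ is a system $X_j=\mu_j+\sum_{i\in\mathrm{pa}_D(j)} f_{j,i}(X_i)+\varepsilon_j$, $j=1,\dots,p$, where $\mu_j\in\mathbb{R}$, $f_{j,i}\in C^2(\mathbb{R})$, $f_{j,i}\not\equiv 0$, $\mathbb{E}[f_{j,i}(X_i)]=0$, and $\varepsilon_1,\dots,\varepsilon_p$ are mutually independent with $\varepsilon_j\sim\mathcal{N}(0,\sigma_j^2)$, $\sigma_j^2>0$; the distribution of the solution $X$ is said to be generated by the PLSEM. Its PLSEM-function is $F:\mathbb{R}^p\to\mathbb{R}^p$, $F(x)_j=\frac{1}{\sigma_j}\big(x_j-\mu_j-\sum_{i\in\mathrm{pa}_D(j)}f_{j,i}(x_i)\big)$. $\mathrm{D}F(x)$ is the Jacobian of $F$ (invertible), $\partial_i^2F(x)\in\mathbb{R}^p$ the vector of second partial derivatives of the components of $F$ with respect to $x_i$, $e_j$ the $j$-th standard basis vector; ''$\not\equiv0$'' means not zero for all $x\in\mathbb{R}^p$. $\mathcal{S}(\mathbb{P})$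 is the set of permutations $\sigma$ of $\{1,\dots,p\}$ for which there exists a PLSEM with some DAG $D$ generating $\mathbb{P}$ such that $\sigma(i)<\sigma(j)$ for every edge $i\to j$ of $D$. *)

(* Defs.v *)
From HB Require Import structures.
From mathcomp Require Import all_boot all_order all_algebra all_fingroup.
From mathcomp Require Import all_classical all_reals all_analysis.
Set Implicit Arguments. Unset Strict Implicit. Unset Printing Implicit Defensive.
Import Order.TTheory GRing.Theory Num.Theory.
Import numFieldNormedType.Exports.
Local Open Scope classical_set_scope.
Local Open Scope ring_scope.

Section PLSEM.
Context {R : realType} {p : nat}.

Record plsem := PLSEM {
  dag : rel 'I_p;
  mu : 'I_p -> R;
  fn : 'I_p -> 'I_p -> R -> R;
  sd : 'I_p -> R }.

Definition acyclic (D : rel 'I_p) : Prop :=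
  forall i j, D i j -> ~~ connect D j i.

Definition C2 (f : R -> R) : Prop :=
  (forall x, derivable f x 1) /\ (forall x, derivable (derive1 f) x 1) /\
  continuous (derive1n 2 f).

Definition plsem_wf (M : plsem) : Prop :=
  [/\ acyclic (dag M), (forall j, 0 < sd M j) &
      forall i j, dag M i j -> C2 (fn M j i) /\ exists x, fn M j i x != 0].

Definition mutually_independent d (Omega : measurableType d)
    (Q : probability Omega R) (eps : 'I_p -> Omega -> R) : Prop :=
  forall (J : {set 'I_p}) (B : 'I_p -> set R), (forall j, measurable (B j)) ->
    Q (\bigcap_(j in [set j | j \in J]) (eps j @^-1` B j)) =
    (\big[*%E/1%E]_(j in J) Q (eps j @^-1` B j))%E.

Definition generates (P : probability (p.-tuple R) R) (M : plsem) : Prop :=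
  plsem_wf M /\
  exists (d : measure_display) (Omega : measurableType d)
         (Q : probability Omega R) (X eps : 'I_p -> Omega -> R),
  [/\ (forall j, measurable_fun setT (eps j)) /\
      (forall j, measurable_fun setT (X j)),
      mutually_independent Q eps,
      (forall j (B : set R), measurable B ->
          Q (eps j @^-1` B) = normal_prob 0 (sd M j) B),
      (forall j w, X j w = mu M j + \sum_(i | dag M i j) fn M j i (X i w) + eps j w) /\
      (forall i j, dag M i j ->
          Q.-integrable setT (fun w => (fn M j i (X i w))%:E) /\
          (\int[Q]_w (fn M j i (X i w))%:E = 0)%E) &
      (forall B : set (p.-tuple R), measurable B ->
          Q ((fun w => [tuple X i w | i < p]) @^-1` B) = P B)].

Definition plsem_fun (M : plsem) (x : 'rV[R]_p) : 'rV[R]_p :=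
  \row_j ((sd M j)^-1 * (x 0 j - mu M j - \sum_(i | dag M i j) fn M j i (x 0 i))).

Definition jacobian (F : 'rV[R]_p -> 'rV[R]_p) (x : 'rV[R]_p) : 'M[R]_p :=
  \matrix_(j, k) ('D_(delta_mx 0 k) F x) 0 j.

Definition second_partial (F : 'rV[R]_p -> 'rV[R]_p) (i : 'I_p) (x : 'rV[R]_p) : 'rV[R]_p :=
  'D_(delta_mx 0 i) ('D_(delta_mx 0 i) F) x.

Definition Vset (M : plsem) : set ('I_p * 'I_p) :=
  [set ij | exists x : 'rV[R]_p,
     (invmx (jacobian (plsem_fun M) x) *m (second_partial (plsem_fun M) ij.1 x)^T)
        ij.2 0 != 0].

Definition Sset (P : probability (p.-tuple R) R) : set {perm 'I_p} :=
  [set s : {perm 'I_p} | exists M : plsem, generates P M /\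
     forall i j, dag M i j -> (s i < s j)%N].

End PLSEM.
Arguments plsem : clear implicits.

(* Main.v *)
Require Import Defs.
From HB Require Import structures.
From mathcomp Require Import all_boot all_order all_algebra all_fingroup.
From mathcomp Require Import all_classical all_reals all_analysis.
From mathcomp Require Import measurable_realfun ring lra.
Set Implicit Arguments. Unset Strict Implicit. Unset Printing Implicit Defensive.
Import Order.TTheory GRing.Theory Num.Theory.
Import numFieldNormedType.Exports.
Local Open Scope classical_set_scope.
Local Open Scope ring_scope.

(** Along a topological order the map [x |-> eps] of a PLSEM is a composition of
    shears [x_j := x_j + m_j(earlier coordinates)], so it preserves Lebesgue measure
    and [P] has density [C * exp (- |F x|^2 / 2)]. If [F] and [G] come from two PLSEMs
    generating [P], then [|F|^2 - |G|^2] is constant by continuity. Every [F] is a sum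
    [F x = sum_i h_i (x_i)] of curves; differentiating this identity shows that the
    Gram matrices of [DF] and [DG] agree off the diagonal, and a descending induction
    along the order of [G] gives [(DF)^-1 d_i^2 F = (DG)^-1 d_i^2 G] at every point.
    Hence [V] is the same for both, and the triangular form of [DG] makes every order
    of [G] compatible with [V].

    Conversely, if [s] is compatible with [V], let [O] be an orthogonal matrix for
    which [O * DF(0)] is triangular along [s] with positive diagonal. The condition on
    [V] says that [h_i''] always lies in the span of the later [h_k'], so that span is
    constant and [O * DF(x)] remains triangular, with constant diagonal. Thus [O F] is
    again a PLSEM-function, ordered by [s]; since [|O F| = |F|], the density formula
    shows that the new noise variables are independent Gaussians. *)

(** * Lebesgue measure on tuples *)

Section TupleLebesgue.
Context {R : realType}.
Local Notation leb := (@lebesgue_measure R).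

Definition box n (B : 'I_n -> set R) : set (n.-tuple R) :=
  [set x | forall i, B i (tnth x i)].

Definition cube n (k : nat) : set (n.-tuple R) :=
  box (fun=> `[- (k%:R : R), k%:R]%classic).

(** The position [j] is arbitrary so that Fubini can later single out whichever coordinate a shear
    moves. *)
Definition insert_coord n (j : 'I_n.+1) (ty : R * n.-tuple R) : n.+1.-tuple R :=
  [tuple if unlift j i is Some k then tnth ty.2 k else ty.1 | i < n.+1].

Lemma tnth_insert_coord n (j : 'I_n.+1) t (y : n.-tuple R) :
  tnth (insert_coord j (t, y)) j = t.
Proof. by rewrite tnth_mktuple unlift_none. Qed.

Lemma tnth_insert_coord_lift n (j : 'I_n.+1) t (y : n.-tuple R) k :
  tnth (insert_coord j (t, y)) (lift j k) = tnth y k.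
Proof. by rewrite tnth_mktuple liftK. Qed.

Lemma measurable_insert_coord n (j : 'I_n.+1) :
  measurable_fun setT (insert_coord j).
Proof.
apply/measurable_fun_tnthP => i.
case: (unliftP j i) => [k ->|->].
  rewrite (_ : _ \o _ = (fun y => tnth y k) \o snd).
    by apply: measurableT_comp => //; exact: measurable_tnth.
  by apply/funext => -[t y] /=; rewrite tnth_insert_coord_lift.
rewrite (_ : _ \o _ = fst) //.
by apply/funext => -[t y] /=; rewrite tnth_insert_coord.
Qed.

HB.instance Definition _ n (j : 'I_n.+1) :=
  isMeasurableFun.Build _ _ _ _ _ (measurable_insert_coord j).

Lemma preimage_box_insert n (j : 'I_n.+1) (B : 'I_n.+1 -> set R) :
  insert_coord j @^-1` box B = B j `*` box (fun k => B (lift j k)).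
Proof.
apply/seteqP; split => -[t y] /=.
  move=> h; split; first by have := h j; rewrite tnth_insert_coord.
  by move=> k; have := h (lift j k); rewrite tnth_insert_coord_lift.
move=> [Bt By] i; case: (unliftP j i) => [k ->|->].
  by rewrite tnth_insert_coord_lift; exact: By.
by rewrite tnth_insert_coord.
Qed.

Lemma measurable_box n (B : 'I_n -> set R) :
  (forall i, measurable (B i)) -> measurable (box B).
Proof.
move=> mB; rewrite (_ : box B = \bigcap_(i in [set: 'I_n]) ((fun x => tnth x i) @^-1` B i)).
  apply: fin_bigcap_measurable => // i _.
  by rewrite -[X in measurable X]setTI; exact: measurable_tnth.
by apply/seteqP; split => x /= h i; [move=> _; exact: h|exact: h].
Qed.

(** Boxes are closed under intersection and generate the sigma-algebra, and the cubes exhaust the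
    space with finite measure. *)
Lemma box_measure_unique n (m1 m2 : {measure set (n.-tuple R) -> \bar R}) :
  (forall B : 'I_n -> set R, (forall i, measurable (B i)) -> m1 (box B) = m2 (box B)) ->
  (forall k : nat, (m1 (@cube n k) < +oo)%E) ->
  forall A, measurable A -> m1 A = m2 A.
Proof.
move=> m12 fin A mA.
pose C : set (set (n.-tuple R)) :=
  [set C | exists2 B : 'I_n -> set R, (forall i, measurable (B i)) & C = box B].
apply: (measure_unique C (@cube n)) => //.
- apply/seteqP; split.
    apply: smallest_sub; first exact: smallest_sigma_algebra.
    rewrite -bigcup_seq => D [i _ [B mB <-]].
    apply: sub_sigma_algebra.
    exists (fun k => if k == i then B else setT); first by move=> k; case: ifP.
    rewrite setTI; apply/seteqP; split => x /=.
      by move=> Bx k; case: eqP => // ->.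
    by move=> /(_ i); rewrite eqxx.
  apply: smallest_sub; first exact: sigma_algebra_measurable.
  by move=> _ [B mB ->]; exact: measurable_box.
- move=> _ _ [B mB ->] [B' mB' ->]; exists (fun i => B i `&` B' i).
    by move=> i; exact: measurableI.
  apply/seteqP; split => x /=; first by move=> [h h'] i; split.
  by move=> h; split => i; case: (h i).
- by move=> k; exists (fun=> `[- (k%:R : R), k%:R]%classic) => // i; exact: measurable_itv.
- rewrite -subTset => x _.
  (* The sum of absolute values bounds every coordinate, and its integer part plus one exceeds
     it. *)
  exists (Num.trunc (\sum_i `|tnth x i|)).+1 => //= i.
  rewrite /= in_itv /= -ler_norml.
  apply: le_trans (ltW (truncnS_gt _)).
  by rewrite (bigD1 i)//= lerDl sumr_ge0.
- by move=> _ [B mB ->]; exact: m12.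
Qed.

Section extend.
Variables (n : nat) (m : {sigma_finite_measure set (n.-tuple R) -> \bar R}).

Definition extend_leb : set (n.+1.-tuple R) -> \bar R :=
  pushforward (leb \x m)%E (insert_coord ord0).

Let push_insert : {measure set (n.+1.-tuple R) -> \bar R}.
Proof.
apply: (pushforward (leb \x m)%E (insert_coord ord0) : {measure set _ -> \bar R}).
exact: measurable_insert_coord.
Defined.

HB.instance Definition _ := Measure.copy extend_leb push_insert.

(** Sigma-finiteness has to be carried through the recursion, since each further product measure
    relies on it. *)
Let extend_leb_sigma_finite : sigma_finite setT extend_leb.
Proof.
have /sigma_finiteP[F [TF ndF Foo]] := sigma_finiteT leb.
have /sigma_finiteP[G [TG ndG Goo]] := sigma_finiteT m.
pose tl (x : n.+1.-tuple R) := [tuple tnth x (lift ord0 k) | k < n].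
have mtl : measurable_fun setT tl.
  apply/measurable_fun_tnthP => k.
  rewrite (_ : _ \o _ = (fun x => tnth x (lift ord0 k))).
    exact: measurable_tnth.
  by apply/funext => x /=; rewrite tnth_mktuple.
exists (fun k => (fun x => tnth x ord0) @^-1` F k `&` tl @^-1` G k).
  apply/esym; rewrite -subTset => x _.
  have [k _ Fk] : (\bigcup_k F k) (tnth x ord0) by rewrite -TF.
  have [l _ Gl] : (\bigcup_k G k) (tl x) by rewrite -TG.
  exists (maxn k l) => //; split.
    have /subsetPset : (F k <= F (maxn k l))%O by exact/ndF/leq_maxl.
    exact.
  have /subsetPset : (G l <= G (maxn k l))%O by exact/ndG/leq_maxr.
  exact.
move=> k; have [mF Fk] := Foo k; have [mG Gk] := Goo k; split.
  apply: measurableI; rewrite -[X in measurable X]setTI; last exact: mtl.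
  exact: measurable_tnth.
rewrite /extend_leb /pushforward.
rewrite (_ : _ @^-1` _ = F k `*` G k).
  by rewrite product_measure1E// lte_mul_pinfty// ge0_fin_numE.
have tlK t (y : n.-tuple R) : tl (insert_coord ord0 (t, y)) = y.
  by apply: eq_from_tnth => l; rewrite tnth_mktuple tnth_insert_coord_lift.
by apply/seteqP; split => -[t y] /=; rewrite tlK tnth_insert_coord.
Qed.

HB.instance Definition _ := @Measure_isSigmaFinite.Build _ _ _ extend_leb
  extend_leb_sigma_finite.

End extend.

(** This is [n]-dimensional Lebesgue measure; in dimension 0 it is the unit mass at the empty
    tuple. *)
Fixpoint tuple_leb n : {sigma_finite_measure set (n.-tuple R) -> \bar R} :=
  match n with
  | 0 => \d_([tuple] : 0.-tuple R)
  | m.+1 => extend_leb (tuple_leb m)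
  end.

Lemma tuple_leb_box n (B : 'I_n -> set R) : (forall i, measurable (B i)) ->
  tuple_leb n (box B) = (\prod_(i < n) leb (B i))%E.
Proof.
elim: n B => [|n IH] B mB /=.
  by rewrite big_ord0 diracE mem_set// => -[].
rewrite /extend_leb /pushforward preimage_box_insert product_measure1E//.
- by rewrite big_ord_recl IH.
- exact: mB.
- exact: measurable_box.
Qed.

Lemma tuple_leb_cube_fin n (k : nat) :
  (tuple_leb n (@cube n k) < +oo)%E.
Proof.
rewrite tuple_leb_box; last by move=> i; exact: measurable_itv.
set P := (X in (X < _)%E); suff [] : (0 <= P)%E /\ (P < +oo)%E by [].
apply: (@big_ind _ (fun x => 0 <= x /\ x < +oo)%E).
- by rewrite ltry.
- by move=> x y [x0 xo] [y0 yo]; split; [exact: mule_ge0|apply: lte_mul_pinfty; rewrite ?ge0_fin_numE].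
- by move=> i _; rewrite lebesgue_measure_itv/=; split; case: ifP => //; rewrite -EFinB ?ltry// lee_fin lte_fin subr_ge0 => /ltW.
Qed.

(** The recursion splits off coordinate 0, but both sides give a box the product of its side
    measures, so any coordinate may be split off instead. *)
Lemma tuple_leb_insert n (j : 'I_n.+1) A : measurable A ->
  tuple_leb n.+1 A = (leb \x tuple_leb n)%E (insert_coord j @^-1` A).
Proof.
move=> mA.
apply: (box_measure_unique (m2 := pushforward (leb \x tuple_leb n)%E (insert_coord j))) => //.
- exact: measurable_insert_coord.
- move=> minsert B mB; rewrite [LHS](tuple_leb_box mB) /= /pushforward preimage_box_insert.
  rewrite product_measure1E//; [|exact: mB|exact: measurable_box].
  by rewrite [in RHS]tuple_leb_box// (bigD1_ord j).
- by move=> *; exact: tuple_leb_cube_fin.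
Qed.

Local Open Scope ereal_scope.
Lemma ge0_integral_tuple_leb_prod n (f : 'I_n -> R -> \bar R) :
  (forall i, measurable_fun setT (f i)) -> (forall i x, 0 <= f i x)%E ->
  (\int[tuple_leb n]_x (\prod_(i < n) f i (tnth x i)) =
   \prod_(i < n) \int[leb]_t f i t)%E.
Proof.
elim: n f => [|n IH] f mf f0.
  rewrite big_ord0; under eq_integral do rewrite big_ord0.
  by rewrite integral_cst//= diracT mule1.
have mprod m (g : 'I_m -> R -> \bar R) : (forall i, measurable_fun setT (g i)) ->
    measurable_fun setT (fun x : m.-tuple R => \prod_(i < m) g i (tnth x i))%E.
  move=> mg; elim: (index_enum _) => [|i s IHs].
    by under eq_fun do rewrite big_nil; exact: measurable_cst.
  under eq_fun do rewrite big_cons.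
  apply: emeasurable_funM => //.
  by apply: measurableT_comp => //; exact: measurable_tnth.
have p0 m (g : 'I_m -> R -> \bar R) x : (forall i x, 0 <= g i x)%E ->
    (0 <= \prod_(i < m) g i (tnth x i))%E.
  by move=> g0; apply: prode_ge0 => i _; exact: g0.
rewrite [LHS]ge0_integral_pushforward//=; first last.
- by move=> x _; exact: p0.
- exact: mprod.
- exact: measurable_insert_coord.
rewrite preimage_setT.
rewrite fubini_tonelli1//=; first last.
- by move=> x; exact: p0.
- exact: (measurableT_comp (mprod _ _ mf) (measurable_insert_coord ord0)).
rewrite /fubini_F.
have inner t : \int[tuple_leb n]_y (\prod_(i < n.+1) f i (tnth (insert_coord ord0 (t, y)) i)) =
    f ord0 t * \prod_(i < n) \int[leb]_t f (lift ord0 i) t.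
  transitivity (\int[tuple_leb n]_y (f ord0 t * \prod_(i < n) f (lift ord0 i) (tnth y i))).
    apply: eq_integral => y _; rewrite big_ord_recl tnth_insert_coord.
    by under eq_bigr do rewrite tnth_insert_coord_lift.
  rewrite ge0_integralZl//.
  - by rewrite (IH (fun i => f (lift ord0 i))).
  - exact: (mprod _ (fun i => f (lift ord0 i))).
  - by move=> y _; exact: (p0 _ (fun i => f (lift ord0 i))).
under eq_integral do rewrite inner.
rewrite ge0_integralZr//.
- by rewrite big_ord_recl.
- exact: mf.
- by apply: prode_ge0 => i _; exact: integral_ge0.
Qed.

Local Close Scope ereal_scope.

Lemma lebesgue_measureD (a : R) (A : set R) : measurable A ->
  leb [set t | A (t + a)] = leb A.
Proof.
move=> mA.
pose sh : R -> measurableTypeR R := fun t => t + a.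
have msh : measurable_fun setT sh by exact: measurable_funD.
pose sh' : {mfun _ >-> _} := HB.pack sh (isMeasurableFun.Build _ _ _ _ _ msh).
have /= := @lebesgue_measure_unique R (pushforward leb sh') _ A mA.
move=> -> // _ [[b c]] _ <-.
rewrite /pushforward /=.
rewrite (_ : _ @^-1` _ = `]b - a, c - a]%classic); last first.
  by apply/seteqP; split => t; rewrite /= !in_itv/= /sh ltrBlDr lerBrDr.
rewrite !lebesgue_measure_itv/= !lte_fin ltrD2r.
by case: ifP => //; rewrite -!EFinB => _; congr EFin; ring.
Qed.

End TupleLebesgue.

(** * Measure-preserving triangular maps *)

Section Shears.
Context {R : realType}.
Local Notation leb := (@lebesgue_measure R).

Definition tset p (x : p.-tuple R) (j : 'I_p) (t : R) : p.-tuple R :=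
  [tuple if i == j then t else tnth x i | i < p].

Lemma tnth_tset p (x : p.-tuple R) j t i :
  tnth (tset x j t) i = if i == j then t else tnth x i.
Proof. by rewrite tnth_mktuple. Qed.

Lemma tset_insert_coord n (j : 'I_n.+1) s t (y : n.-tuple R) :
  tset (insert_coord j (s, y)) j t = insert_coord j (t, y).
Proof.
apply: eq_from_tnth => i; rewrite tnth_tset.
case: (unliftP j i) => [k ->|->]; last by rewrite eqxx tnth_insert_coord.
by rewrite eq_sym (negbTE (neq_lift _ _)) !tnth_insert_coord_lift.
Qed.

Definition shear p (j : 'I_p) (phi : p.-tuple R -> R) (x : p.-tuple R) :=
  tset x j (tnth x j + phi x).

Lemma measurable_shear p (j : 'I_p) phi : measurable_fun setT phi ->
  measurable_fun setT (shear j phi).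
Proof.
move=> mphi; apply/measurable_fun_tnthP => i.
rewrite (_ : _ \o _ = fun x => if i == j then tnth x j + phi x else tnth x i); last first.
  by apply/funext => x; rewrite /= tnth_tset.
case: eqP => _; last exact: measurable_tnth.
by apply: measurable_funD => //; exact: measurable_tnth.
Qed.

(** Since [phi] ignores coordinate [j], the shear is a translation on each line in direction [j];
    Fubini and translation invariance of [leb] conclude. *)
Lemma tuple_leb_shear p (j : 'I_p) phi (A : set (p.-tuple R)) :
  measurable_fun setT phi -> (forall x t, phi (tset x j t) = phi x) ->
  measurable A -> tuple_leb p (shear j phi @^-1` A) = tuple_leb p A.
Proof.
case: p j phi A => [[]//|n] j phi A mphi phij mA.
have mS : measurable (shear j phi @^-1` A).
  by rewrite -[X in measurable X]setTI; exact: measurable_shear.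
(* Coordinate [j] must be integrated innermost, hence the product measure in the reversed order. *)
have swap B : measurable B -> tuple_leb n.+1 B =
    (\int[tuple_leb n]_y leb (ysection (insert_coord j @^-1` B) y))%E.
  move=> mB; rewrite (tuple_leb_insert j mB).
  rewrite (@product_measure_unique _ _ _ _ _ leb (tuple_leb n) (leb \x^ tuple_leb n)%E)//.
    by move=> C D mC mD; exact: product_measure2E.
  by rewrite -[X in measurable X]setTI; exact: measurable_insert_coord.
rewrite !swap//; apply: eq_integral => y _.
pose a := phi (insert_coord j (0, y)).
have shearE t : shear j phi (insert_coord j (t, y)) = insert_coord j (t + a, y).
  rewrite /shear tset_insert_coord tnth_insert_coord /a.
  by rewrite -(tset_insert_coord j t 0 y) phij.
rewrite [X in leb X](_ : _ =
    [set t | ysection (insert_coord j @^-1` A) y (t + a)]).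
  apply: lebesgue_measureD; apply: measurable_ysection.
  by rewrite -[X in measurable X]setTI; exact: measurable_insert_coord.
by apply/seteqP; split => t; rewrite /ysection /= !inE /= shearE.
Qed.

Definition triangular_lt p (r : 'I_p -> nat) (m : 'I_p -> p.-tuple R -> R) (k : nat)
    (x : p.-tuple R) : p.-tuple R :=
  [tuple tnth x j + (if (r j < k)%N then m j x else 0) | j < p].

Definition triangular p (m : 'I_p -> p.-tuple R -> R) (x : p.-tuple R) : p.-tuple R :=
  [tuple tnth x j + m j x | j < p].

(* Only the coordinates of rank less than k are moved; the map for k+1 is the
   map for k preceded by a shear of the coordinate of rank k, whose increment
   the later shears do not change. *)
Lemma tuple_leb_triangular_lt p (r : 'I_p -> nat) (m : 'I_p -> p.-tuple R -> R) (k : nat) :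
  injective r -> (forall j, measurable_fun setT (m j)) ->
  (forall j x y, (forall i, (r i < r j)%N -> tnth x i = tnth y i) -> m j x = m j y) ->
  let E := triangular_lt r m k in
  [/\ measurable_fun setT E,
      (exists2 H, measurable_fun setT H & cancel E H) &
      forall A, measurable A -> tuple_leb p (E @^-1` A) = tuple_leb p A].
Proof.
move=> rinj mm mloc; elim: k => [|k [mE [H mH EH] volE]] /=.
  have -> : triangular_lt r m 0 = id.
    by apply/funext => x; apply: eq_from_tnth => j; rewrite tnth_mktuple addr0.
  by split=> //; exists id.
have [[j rj]|nj] := pselect (exists j, r j = k); last first.
  have -> : triangular_lt r m k.+1 = triangular_lt r m k.
    apply/funext => x; apply: eq_from_tnth => j; rewrite !tnth_mktuple ltnS leq_eqVlt.
    by case: eqP => // rjk; case: nj; exists j.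
  by split=> //; exists H.
have mset x t : m j (tset x j t) = m j x.
  apply: mloc => i ri; rewrite tnth_tset; case: eqP => // ij.
  by rewrite ij ltnn in ri.
have -> : triangular_lt r m k.+1 = triangular_lt r m k \o shear j (m j).
  apply/funext => x; apply: eq_from_tnth => i; rewrite /triangular_lt !tnth_mktuple /shear.
  case: (eqVneq i j) => [->|ij]; first by rewrite rj ltnSn ltnn addr0.
  have rik : r i != k by rewrite -rj; apply: contra_neq ij => /rinj.
  rewrite ltnS leq_eqVlt (negbTE rik) /=; case: ifP => // ik.
  congr (_ + _); apply: mloc => l rl; rewrite tnth_tset; case: eqP => // lj.
  by move: rl; rewrite lj rj ltnNge (ltnW ik).
split.
- exact: measurableT_comp mE (measurable_shear j (mm j)).
- exists (shear j (fun x => - m j x) \o H).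
    apply: measurableT_comp mH; apply: measurable_shear.
    exact: measurableT_comp.
  move=> x /=; rewrite EH; apply: eq_from_tnth => i.
  rewrite !tnth_tset eqxx mset; case: eqP => [->|//].
  by rewrite addrK.
- move=> A mA; rewrite comp_preimage tuple_leb_shear//; first exact: volE.
  by rewrite -[X in measurable X]setTI; exact: mE.
Qed.

Lemma tuple_leb_triangular p (r : 'I_p -> nat) (m : 'I_p -> p.-tuple R -> R) :
  injective r -> (forall j, measurable_fun setT (m j)) ->
  (forall j x y, (forall i, (r i < r j)%N -> tnth x i = tnth y i) -> m j x = m j y) ->
  let E := triangular m in
  [/\ measurable_fun setT E,
      (exists2 H, measurable_fun setT H & cancel E H) &
      forall A, measurable A -> tuple_leb p (E @^-1` A) = tuple_leb p A].
Proof.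
move=> rinj mm mloc E.
(* Every rank lies below the successor of the maximal one, so the truncated map at this level moves
   all coordinates. *)
rewrite /E (_ : triangular m = triangular_lt r m (\max_i r i).+1).
  exact: tuple_leb_triangular_lt.
apply/funext => x; apply: eq_from_tnth => j; rewrite !tnth_mktuple.
by rewrite ltnS leq_bigmax.
Qed.

End Shears.

(** * Gaussian product densities and their transport by volume-preserving maps *)

Section Density.
Context {R : realType} {d} {T : measurableType d}.
Variables (mu : {measure set T -> \bar R}) (f : T -> R).
Hypotheses (mf : measurable_fun setT f) (f0 : forall x, 0 <= f x).

Definition with_density (A : set T) : \bar R := (\int[mu]_(x in A) (f x)%:E)%E.

Let with_density0 : with_density set0 = 0%E.
Proof. exact: integral_set0. Qed.

Let with_density_ge0 A : (0 <= with_density A)%E.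
Proof. by apply: integral_ge0 => x _; rewrite lee_fin. Qed.

Let with_density_sigma_additive : semi_sigma_additive with_density.
Proof.
move=> F mF tF mUF; rewrite /with_density ge0_integral_bigcup//.
- by apply: is_cvg_ereal_nneg_natsum_cond => n _ _; exact: with_density_ge0.
- by apply: measurable_funTS; exact/measurable_EFinP.
- by move=> x _; rewrite lee_fin.
Qed.

HB.instance Definition _ := isMeasure.Build _ _ _ with_density
  with_density0 with_density_ge0 with_density_sigma_additive.

Lemma with_density_measure : exists nu : {measure set T -> \bar R},
  forall A, nu A = (\int[mu]_(x in A) (f x)%:E)%E.
Proof. by exists with_density. Qed.

End Density.

Section GaussianDensity.
Context {R : realType} {p : nat}.
Implicit Types s : 'I_p -> R.

Definition gauss_density s (z : p.-tuple R) : R :=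
  \prod_(j < p) normal_pdf 0 (s j) (tnth z j).

Lemma gauss_density_ge0 s z : 0 <= gauss_density s z.
Proof. by apply: prodr_ge0 => j _; exact: normal_pdf_ge0. Qed.

Lemma measurable_gauss_density s : measurable_fun setT (gauss_density s).
Proof.
apply: measurable_prod => j _.
by apply: measurableT_comp; [exact: measurable_normal_pdf|exact: measurable_tnth].
Qed.

Lemma integral_gauss_density_box s (B : 'I_p -> set R) : (forall j, measurable (B j)) ->
  (\int[tuple_leb p]_(z in box B) (gauss_density s z)%:E =
   \prod_(j < p) normal_prob 0 (s j) (B j))%E.
Proof.
(* The indicator of a box is the product of the indicators of its sides, which turns the integrand
   into a product of one-variable functions. *)
move=> mB; pose f j : R -> \bar R := ((EFin \o normal_pdf 0 (s j)) \_ (B j)).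
transitivity (\int[tuple_leb p]_z \prod_(j < p) f j (tnth z j))%E.
  rewrite integral_mkcond; apply: eq_integral => z _.
  rewrite patchE; case: ifPn => [|zB].
    rewrite inE => zB; rewrite /gauss_density -prodEFin; apply: eq_bigr => j _.
    by rewrite /f patchE mem_set//; exact: zB.
  have [j zj] : exists j, ~ B j (tnth z j).
    by apply/existsNP => h; move: zB; rewrite notin_setE; exact.
  by rewrite (bigD1 j)//= /f patchE memNset// mul0e.
rewrite ge0_integral_tuple_leb_prod.
- by apply: eq_bigr => j _; rewrite /normal_prob [RHS]integral_mkcond.
- move=> j; apply: (measurable_restrictT _ (mB j)).1; apply: measurable_funTS.
  by apply/measurable_EFinP; exact: measurable_normal_pdf.
- by move=> j t; rewrite /f patchE; case: ifP => // _; rewrite lee_fin normal_pdf_ge0.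
Qed.

Variables (E : p.-tuple R -> p.-tuple R).
Hypotheses (mE : measurable_fun setT E)
  (Einv : exists2 H, measurable_fun setT H & cancel E H)
  (volE : forall A, measurable A -> tuple_leb p (E @^-1` A) = tuple_leb p A).

Lemma ge0_integral_comp_volume (f : p.-tuple R -> R) (B : set (p.-tuple R)) :
  measurable_fun setT f -> (forall x, 0 <= f x) -> measurable B ->
  (\int[tuple_leb p]_(x in E @^-1` B) (f (E x))%:E = \int[tuple_leb p]_(z in B) (f z)%:E)%E.
Proof.
move=> mf f0 mB.
rewrite -(@ge0_integral_pushforward _ _ _ _ R E mE (tuple_leb p) B (EFin \o f))//.
- by apply: eq_measure_integral => A mA _; exact: volE.
- by apply: measurable_funTS; exact/measurable_EFinP.
- by move=> z _; rewrite lee_fin.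
Qed.

(** The hypothesis describes the law of [E] on boxes, so that law is the Gaussian product
    everywhere; volume preservation of [E] then pulls its density back to [P]. *)
Lemma gauss_pushforward_density s (P : {measure set (p.-tuple R) -> \bar R}) :
  (forall B : 'I_p -> set R, (forall j, measurable (B j)) ->
     P (E @^-1` box B) = (\prod_(j < p) normal_prob 0 (s j) (B j))%E) ->
  forall A, measurable A -> P A = (\int[tuple_leb p]_(x in A) (gauss_density s (E x))%:E)%E.
Proof.
move=> PB A mA; have [H mH EH] := Einv.
have [nu nuE] := with_density_measure (tuple_leb p) (measurable_gauss_density s)
  (gauss_density_ge0 s).
have PE B : measurable B -> P (E @^-1` B) = nu B.
  move=> mB.
  apply: (@box_measure_unique R p (pushforward P E) nu) => //.
    by move=> C mC; rewrite nuE integral_gauss_density_box//; exact: PB.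
  move=> k; rewrite /= /pushforward PB; last by move=> j; exact: measurable_itv.
  rewrite (@le_lt_trans _ _ 1%E) ?ltry//.
  set Q := (X in (X <= _)%E); suff [] : (0 <= Q)%E /\ (Q <= 1)%E by [].
  apply: (@big_ind _ (fun x => 0 <= x /\ x <= 1)%E) => //.
    move=> x y [x0 x1] [y0 y1]; split; first exact: mule_ge0.
    by rewrite -[leRHS]mule1 lee_pmul.
  by move=> j _; split; [exact: measure_ge0|exact: probability_le1].
(* The left inverse [H] exhibits every measurable set as a preimage under [E], so knowing the law of
   [E] determines [P]. *)
have -> : A = E @^-1` (H @^-1` A).
  by apply/seteqP; split => x /=; rewrite EH.
have mHA : measurable (H @^-1` A) by rewrite -[X in measurable X]setTI; exact: mH.
rewrite PE// nuE ge0_integral_comp_volume//.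
- exact: measurable_gauss_density.
- exact: gauss_density_ge0.
Qed.

End GaussianDensity.

(** * Equality of continuous densities *)

Section ContinuousDensities.
Context {R : realType}.

Definition rv_of_tuple p (x : p.-tuple R) : 'rV[R]_p := \row_i tnth x i.

(** If [v x0 < u x0], two levels separate [v] from [u] on a small box around [x0], and the integrals
    over that box are then in the wrong order. *)
Lemma continuous_density_le p (u v : 'rV[R]_p -> R) :
  continuous u -> continuous v ->
  measurable_fun setT (u \o @rv_of_tuple p) -> measurable_fun setT (v \o @rv_of_tuple p) ->
  (forall x, 0 <= u x) -> (forall x, 0 <= v x) ->
  (forall A, measurable A ->
    (\int[tuple_leb p]_(x in A) (u (rv_of_tuple x))%:E <=
     \int[tuple_leb p]_(x in A) (v (rv_of_tuple x))%:E)%E) ->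
  forall x, u x <= v x.
Proof.
move=> cu cv mu mv u0 v0 uv x0; rewrite leNgt; apply/negP => vu.
(* Cutting the gap into thirds gives [v x0 < b < a < u x0]. *)
pose b := v x0 + (u x0 - v x0) / 3; pose a := u x0 - (u x0 - v x0) / 3.
have vb : v x0 < b by rewrite /b; lra.
have ba : b < a by rewrite /a /b; lra.
have au : a < u x0 by rewrite /a; lra.
have b0 : 0 <= b by apply: le_trans (ltW vb); exact: v0.
have nu : \forall x \near x0, a < u x by have /cvgr_gt := cu x0; exact.
have nv : \forall x \near x0, v x < b by have /cvgr_lt := cv x0; exact.
have /nbhs_ballP[e /= e0 He] : nbhs x0 [set x | a < u x /\ v x < b].
  by near=> x; split; near: x.
(* Half the radius keeps the closed box inside the open ball; its sides then have length [e]. *)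
pose B (i : 'I_p) : set R := `[x0 0 i - e / 2, x0 0 i + e / 2]%classic.
have mB i : measurable (B i) by exact: measurable_itv.
have mbB := measurable_box mB.
have inB x : box B x -> a < u (rv_of_tuple x) /\ v (rv_of_tuple x) < b.
  move=> xB; apply: He; split=> // i j; rewrite ord1 /= !mxE /ball /=.
  have := xB j; rewrite /B /= in_itv /= => /andP[h1 h2].
  by rewrite ltr_norml; apply/andP; split; lra.
have lB : tuple_leb p (box B) = (e ^+ p)%:E.
  rewrite tuple_leb_box//.
  rewrite (eq_bigr (fun=> e%:E)) ?prodEFin ?prodr_const ?card_ord// => i _.
  rewrite lebesgue_measure_itv /= lte_fin ifT; last by lra.
  by rewrite -EFinB; congr EFin; lra.
have ep : 0 < e ^+ p by exact: exprn_gt0.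
have h1 : ((a * e ^+ p)%:E <= \int[tuple_leb p]_(x in box B) (u (rv_of_tuple x))%:E)%E.
  rewrite EFinM -lB -integral_cst//; apply: ge0_le_integral => //.
  - by move=> x _; rewrite lee_fin; lra.
  - by apply: measurable_funTS; apply/measurable_EFinP.
  - by move=> x xB; rewrite lee_fin; have [/ltW] := inB _ xB.
have h2 : (\int[tuple_leb p]_(x in box B) (v (rv_of_tuple x))%:E <= (b * e ^+ p)%:E)%E.
  rewrite EFinM -lB -integral_cst//; apply: ge0_le_integral => //.
  - by move=> x _; rewrite lee_fin.
  - by apply: measurable_funTS; apply/measurable_EFinP.
  - by move=> x xB; rewrite lee_fin; have [_ /ltW] := inB _ xB.
have := le_trans h1 (le_trans (uv _ mbB) h2).
by rewrite lee_fin ler_pM2r// leNgt ba.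
Unshelve. all: by end_near. Qed.

End ContinuousDensities.

(** * Sums of curves in the coordinates *)

Section LineDerivative.
Context {R : realType}.

(** A directional derivative only sees the restriction to a line: the two difference quotients are
    the same function of [h]. *)
Lemma is_derive_line (V W : normedModType R) (f : V -> W) (g : R -> W) x v t df :
  (forall h : R, f (h *: v + x) = g (h + t)) -> is_derive t (1 : R) g df -> is_derive x v f df.
Proof.
move=> fg [dg gE].
have E : (fun h : R => h^-1 *: ((f \o shift x) (h *: v) - f x)) =
         (fun h : R => h^-1 *: ((g \o shift t) (h *: (1 : R)) - g t)).
  apply/funext => h /=; rewrite fg.
  have -> : f x = g t by have := fg 0; rewrite scale0r !add0r.
  by rewrite /GRing.scale /= mulr1.
by split; rewrite /derivable /derive E.
Qed.

Lemma is_derive_row n (g : R -> 'rV[R]_n) (dg : 'rV[R]_n) t :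
  (forall j, is_derive t (1 : R) (fun s => g s 0 j) (dg 0 j)) -> is_derive t (1 : R) g dg.
Proof.
move=> h; have dgt : derivable g t 1.
  by apply/derivable_mxP => i j; rewrite ord1; exact: ex_derive.
split=> //; rewrite derive_mx//; apply/matrixP => i j; rewrite ord1 mxE.
exact: derive_val.
Qed.

Lemma is_derive_sum_fun (I : finType) (f : I -> R -> R) (df : I -> R) t :
  (forall i, is_derive t (1 : R) (f i) (df i)) ->
  is_derive t (1 : R) (fun s => \sum_i f i s) (\sum_i df i).
Proof.
move=> h; elim: (index_enum I) => [|i l IH].
  rewrite big_nil; under eq_fun do rewrite big_nil; exact: is_derive_cst.
rewrite big_cons; under eq_fun do rewrite big_cons; exact: is_deriveD.
Qed.

Lemma is_derive_unique (f : R -> R) t a b :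
  is_derive t (1 : R) f a -> is_derive t (1 : R) f b -> a = b.
Proof. by move=> [_ <-] [_ <-]. Qed.

Lemma is_derive_ext (f g : R -> R) t a : f =1 g ->
  is_derive t (1 : R) f a -> is_derive t (1 : R) g a.
Proof. by move=> /funext ->. Qed.

End LineDerivative.

Section Additive.
Context {R : realType} {p : nat}.
Implicit Types (K : 'I_p -> 'I_p -> R -> R) (x : 'rV[R]_p).

(** [K j i] is the [j]-th component of the curve carried by coordinate [i], so each partial
    derivative involves a single curve. *)
Definition additive_map K x : 'rV[R]_p := \row_j \sum_i K j i (x 0 i).

Definition setc x k (s : R) : 'rV[R]_p := \row_i (if i == k then s else x 0 i).

Lemma setcE x k s i : setc x k s 0 i = if i == k then s else x 0 i.
Proof. by rewrite mxE. Qed.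

Lemma setc_id x k : setc x k (x 0 k) = x.
Proof. by apply/rowP => i; rewrite mxE; case: eqP => // ->. Qed.

Lemma additive_setc K x k s j :
  additive_map K (setc x k s) 0 j = \sum_(i | i != k) K j i (x 0 i) + K j k s.
Proof.
rewrite mxE (bigD1 k)//= setcE eqxx addrC; congr (_ + _).
by apply: eq_bigr => i /negbTE ik; rewrite setcE ik.
Qed.

Lemma setc_line x k h : h *: delta_mx 0 k + x = setc x k (h + x 0 k).
Proof.
by apply/rowP => i; rewrite !mxE eqxx /=; case: eqP => [->|_];
  rewrite ?mulr1 ?mulr0 ?add0r.
Qed.

Variables (K K1 K2 : 'I_p -> 'I_p -> R -> R).
Hypotheses (dK : forall j i t, is_derive t (1 : R) (K j i) (K1 j i t))
           (dK1 : forall j i t, is_derive t (1 : R) (K1 j i) (K2 j i t)).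

Lemma is_derive_additive_setc x k j s :
  is_derive s (1 : R) (fun s => additive_map K (setc x k s) 0 j) (K1 j k s).
Proof.
apply: (is_derive_ext (f := fun s => cst (\sum_(i | i != k) K j i (x 0 i)) s + K j k s)).
  by move=> u; rewrite additive_setc.
by rewrite -[X in is_derive _ _ _ X]add0r; exact: is_deriveD.
Qed.

Lemma derive_additive x k :
  is_derive x (delta_mx 0 k) (additive_map K) (\row_j K1 j k (x 0 k)).
Proof.
apply: (@is_derive_line _ _ _ _ (fun s => additive_map K (setc x k s)) _ _ (x 0 k)).
  by move=> h; rewrite setc_line.
by apply: is_derive_row => j; rewrite mxE; exact: is_derive_additive_setc.
Qed.

Lemma jacobian_additive x : Defs.jacobian (additive_map K) x = \matrix_(j, k) K1 j k (x 0 k).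
Proof.
apply/matrixP => j k; rewrite [LHS]mxE [RHS]mxE.
by have [_ ->] := derive_additive x k; rewrite mxE.
Qed.

Lemma second_partial_additive x i :
  second_partial (additive_map K) i x = \row_j K2 j i (x 0 i).
Proof.
rewrite /second_partial.
have -> : 'D_(delta_mx 0 i) (additive_map K) = fun y => \row_j K1 j i (y 0 i).
  by apply/funext => y; have [_ ->] := derive_additive y i.
suff [] : is_derive x (delta_mx 0 i) (fun y : 'rV[R]_p => \row_j K1 j i (y 0 i) : 'rV[R]_p)
  (\row_j K2 j i (x 0 i)) by [].
apply: (@is_derive_line _ _ _ _ (fun s => \row_j K1 j i s) _ _ (x 0 i)).
  by move=> h; rewrite !mxE !eqxx mulr1.
by apply: is_derive_row => j; rewrite mxE; apply: is_derive_ext (dK1 j i _) => s; rewrite mxE.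
Qed.

End Additive.

(** * Derivatives of the identity between two squared norms *)

Section EqualNorms.
Context {R : realType} {p : nat}.
Implicit Type x : 'rV[R]_p.
Variables (K K1 K2 L L1 L2 : 'I_p -> 'I_p -> R -> R) (c : R).
Hypotheses (dK : forall j i t, is_derive t (1 : R) (K j i) (K1 j i t))
           (dK1 : forall j i t, is_derive t (1 : R) (K1 j i) (K2 j i t))
           (dL : forall j i t, is_derive t (1 : R) (L j i) (L1 j i t))
           (dL1 : forall j i t, is_derive t (1 : R) (L1 j i) (L2 j i t)).
Hypothesis eqn : forall x, \sum_j additive_map K x 0 j ^+ 2 = \sum_j additive_map L x 0 j ^+ 2 + c.

Let sqd (H H1 : 'I_p -> 'I_p -> R -> R) x i :
  (forall j i t, is_derive t (1 : R) (H j i) (H1 j i t)) ->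
  is_derive (x 0 i) (1 : R) (fun s => \sum_j additive_map H (setc x i s) 0 j ^+ 2)
    ((\sum_j additive_map H x 0 j * H1 j i (x 0 i)) *+ 2).
Proof.
move=> dH; rewrite -sumrMnl; apply: is_derive_sum_fun => j.
have h := is_derive_additive_setc dH x i j (x 0 i).
apply: (is_derive_ext (f := (fun s => additive_map H (setc x i s) 0 j) * (fun s => additive_map H (setc x i s) 0 j))) => //.
apply: is_derive_eq; rewrite setc_id /GRing.scale /= mulr2n; ring.
Qed.

Lemma norm_grad_eq x i :
  \sum_j additive_map K x 0 j * K1 j i (x 0 i) = \sum_j additive_map L x 0 j * L1 j i (x 0 i).
Proof.
have h1 := sqd x i dK; have h2 := sqd x i dL.
apply: (@pmulrnI R 2 isT).
apply: (is_derive_unique h1).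
apply: (is_derive_ext (f := fun s => \sum_j additive_map L (setc x i s) 0 j ^+ 2 + cst c s)).
  by move=> s; rewrite eqn.
by rewrite -[X in is_derive _ _ _ X]addr0; exact: is_deriveD.
Qed.

Let gradd (H H1 : 'I_p -> 'I_p -> R -> R) x i k : i != k ->
  (forall j i t, is_derive t (1 : R) (H j i) (H1 j i t)) ->
  is_derive (x 0 k) (1 : R)
    (fun s => \sum_j additive_map H (setc x k s) 0 j * H1 j i (setc x k s 0 i))
    (\sum_j H1 j k (x 0 k) * H1 j i (x 0 i)).
Proof.
move=> ik dH; apply: is_derive_sum_fun => j.
have h := is_derive_additive_setc dH x k j (x 0 k).
apply: (is_derive_ext (f := (fun s => additive_map H (setc x k s) 0 j) * cst (H1 j i (x 0 i)))).
  by move=> s; rewrite setcE (negbTE ik).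
by apply: is_derive_eq; rewrite /GRing.scale /= mulr0 add0r mulrC.
Qed.

(** Differentiate [norm_grad_eq] in [x_k]: as [i != k], the factor [K1 j i (x 0 i)] is frozen and no
    second derivative appears. *)
Lemma gram_offdiag_eq x i k : i != k ->
  \sum_j K1 j k (x 0 k) * K1 j i (x 0 i) = \sum_j L1 j k (x 0 k) * L1 j i (x 0 i).
Proof.
move=> ik; apply: is_derive_unique (gradd x ik dK) _.
by apply: is_derive_ext (gradd x ik dL) => s; rewrite -norm_grad_eq.
Qed.

Let graddd (H H1 H2 : 'I_p -> 'I_p -> R -> R) x i :
  (forall j i t, is_derive t (1 : R) (H j i) (H1 j i t)) ->
  (forall j i t, is_derive t (1 : R) (H1 j i) (H2 j i t)) ->
  is_derive (x 0 i) (1 : R)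
    (fun s => \sum_j additive_map H (setc x i s) 0 j * H1 j i (setc x i s 0 i))
    (\sum_j (H1 j i (x 0 i) * H1 j i (x 0 i) + additive_map H x 0 j * H2 j i (x 0 i))).
Proof.
move=> dH dH1; apply: is_derive_sum_fun => j.
have h := is_derive_additive_setc dH x i j (x 0 i).
have h1 := dH1 j i (x 0 i).
apply: (is_derive_ext (f := (fun s => additive_map H (setc x i s) 0 j) * H1 j i)).
  by move=> s; rewrite setcE eqxx.
by apply: is_derive_eq; rewrite setc_id /GRing.scale /= addrC.
Qed.

(** Differentiating [norm_grad_eq] in the same variable [x_i] makes both factors move, which
    produces the extra second-derivative term. *)
Lemma gram_diag_eq x i :
  \sum_j (K1 j i (x 0 i) * K1 j i (x 0 i) + additive_map K x 0 j * K2 j i (x 0 i)) =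
  \sum_j (L1 j i (x 0 i) * L1 j i (x 0 i) + additive_map L x 0 j * L2 j i (x 0 i)).
Proof.
apply: is_derive_unique (graddd x i dK dK1) _.
by apply: is_derive_ext (graddd x i dL dL1) => s; rewrite -norm_grad_eq.
Qed.

(** Differentiate [gram_offdiag_eq] in [x_i], on which only one of the two factors depends. *)
Lemma gram_second_eq x i k : i != k ->
  \sum_j K2 j i (x 0 i) * K1 j k (x 0 k) = \sum_j L2 j i (x 0 i) * L1 j k (x 0 k).
Proof.
move=> ik.
have E (H1 H2 : 'I_p -> 'I_p -> R -> R) :
    (forall j i t, is_derive t (1 : R) (H1 j i) (H2 j i t)) ->
    is_derive (x 0 i) (1 : R) (fun s => \sum_j H1 j k (x 0 k) * H1 j i s)
      (\sum_j H2 j i (x 0 i) * H1 j k (x 0 k)).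
  move=> dH1; apply: is_derive_sum_fun => j; have h1 := dH1 j i (x 0 i).
  apply: (is_derive_ext (f := cst (H1 j k (x 0 k)) * H1 j i)) => //.
  by apply: is_derive_eq; rewrite /GRing.scale /= mulr0 addr0 mulrC.
apply: is_derive_unique (E _ _ dK1) _.
apply: is_derive_ext (E _ _ dL1) => s.
have := gram_offdiag_eq (setc x i s) ik.
by rewrite !setcE eqxx eq_sym (negbTE ik).
Qed.

End EqualNorms.

(** * Linear algebra *)

Section TriangularSystems.
Context {R : fieldType} {p : nat}.
Variables (r : 'I_p -> nat) (J : 'M[R]_p).
Hypotheses (Jdiag : forall j, J j j != 0)
  (Jtri : forall j k, k != j -> ~~ (r k < r j)%N -> J j k = 0).

(** Forward substitution along [r]. Stopping at rank [m] lets it apply to right-hand sides that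
    vanish only on the early rows. *)
Lemma triangular_solution_eq0 (c : 'cV[R]_p) (m : nat) :
  (forall j, (r j <= m)%N -> (J *m c) j 0 = 0) -> forall j, (r j <= m)%N -> c j 0 = 0.
Proof.
move=> Jc j; have [n] := ubnP (r j); elim: n j => // n IH j; rewrite ltnS => rn rm.
have := Jc j rm; rewrite mxE (bigD1 j)//= big1 ?addr0.
  by move/eqP; rewrite mulf_eq0 (negbTE (Jdiag j)) => /eqP.
move=> k kj; have [kr|kr] := boolP (r k < r j)%N; last by rewrite Jtri ?mul0r.
by rewrite IH ?mulr0 ?(leq_trans kr)// (leq_trans (ltnW kr)).
Qed.

Lemma triangular_unitmx : J \in unitmx.
Proof.
rewrite -unitmx_tr -row_free_unit -kermx_eq0; apply/eqP/row_matrixP => i.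
rewrite row0; set u := row i _.
have uJ : J *m u^T = 0.
  rewrite -[J]trmxK -trmx_mul; apply/trmx_inj; rewrite trmxK trmx0.
  by apply/sub_kermxP; exact: row_sub.
apply/rowP => j; rewrite [RHS]mxE.
have := @triangular_solution_eq0 u^T (r j) _ j (leqnn _); rewrite mxE; apply.
by move=> k _; rewrite uJ mxE.
Qed.

End TriangularSystems.

Section SameSolutions.
Context {R : realFieldType} {p : nat}.
Implicit Types (A B : 'M[R]_p).

Lemma tr_mul_eq0 n (e : 'cV[R]_n) : e^T *m e = 0 -> e = 0.
Proof.
move=> /(congr1 (fun M : 'M[R]_1 => M 0 0)); rewrite !mxE.
under eq_bigr do rewrite mxE -expr2.
move/eqP; rewrite psumr_eq0; last by move=> i _; exact: sqr_ge0.
move=> /allP h; apply/colP => i; rewrite mxE; apply/eqP.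
by have := h i (mem_index_enum i); rewrite sqrf_eq0.
Qed.

Variables (A B : 'M[R]_p) (s : 'I_p -> nat) (m : nat).
Variables (c d : 'I_p -> 'cV[R]_p) (f g : 'cV[R]_p).
Hypotheses (uA : A \in unitmx) (sm : forall i, (s i < m)%N).
Hypothesis gram : forall i k, i != k -> (A^T *m A) i k = (B^T *m B) i k.
Hypothesis gram2 : forall i k, i != k -> (A^T *m (A *m c i)) k 0 = (B^T *m (B *m d i)) k 0.
Hypothesis grad : A^T *m f = B^T *m g.
Hypothesis diag : forall i, (A^T *m A) i i + (f^T *m (A *m c i)) 0 0 =
  (B^T *m B) i i + (g^T *m (B *m d i)) 0 0.
Hypothesis ci : forall i, c i i 0 = 0.
Hypothesis di : forall i k, ~~ (s i < s k)%N -> d i k 0 = 0.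

(** Descending induction along [s]. With [e = c i - d i], the vector [A^T A e] can be nonzero only
    at entry [i], where [e] itself vanishes; hence [|A e|^2 = 0]. *)
Lemma same_solutions i : c i = d i.
Proof.
have [n] := ubnP (m - s i); elim: n i => // n IH i; rewrite ltnS => msn.
(* For a later [k] the induction hypothesis [c k = d k] makes the second-order terms of [diag]
   equal, since the gradients agree; the diagonal Gram entries are left. *)
have gramk k : (s i < s k)%N -> (A^T *m A) k k = (B^T *m B) k k.
  move=> ik; have := diag k; rewrite (IH k); last first.
    by apply: leq_trans msn; apply: ltn_sub2l => //; exact: sm.
  rewrite !mulmxA -[f^T *m A]trmxK trmx_mul trmxK grad -[B^T *m g]trmxK trmx_mul !trmxK.
  by move/addIr.
pose e := c i - d i.
(* By [gram2], this entry is that of [B^T B - A^T A] applied to [d i]. Only the diagonal term could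
   survive; it is killed by [gramk] for later [k] and by [d i k 0 = 0] otherwise. *)
have Ae : forall k, k != i -> (A^T *m (A *m e)) k 0 = 0.
  move=> k ki; rewrite /e !mulmxBr [LHS]mxE gram2 1?eq_sym// [X in _ + X]mxE !mulmxA.
  rewrite !mxE -sumrB big1// => l _.
  have [->|lk] := eqVneq l k; last by rewrite gram 1?eq_sym// subrr.
  have [ik|ik] := boolP (s i < s k)%N; first by rewrite gramk// subrr.
  by rewrite di// !mulr0 subrr.
suff : A *m e = 0.
  by move=> /(congr1 (mulmx (invmx A))); rewrite mulKmx// mulmx0 => /subr0_eq.
apply: tr_mul_eq0; rewrite trmx_mul -mulmxA; apply/matrixP => a b.
rewrite !ord1 [LHS]mxE [RHS]mxE big1// => k _.
have [->|ki] := eqVneq k i; last by rewrite Ae// mulr0.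
by rewrite mxE /e mxE ci mxE di ?ltnn// subrr mul0r.
Qed.

End SameSolutions.

Section Orthogonal.
Context {R : rcfType}.

Lemma tr_mul_eq0_rV n (e : 'rV[R]_n) : e *m e^T = 0 -> e = 0.
Proof.
by rewrite -{1}[e]trmxK => /tr_mul_eq0 /(congr1 trmx); rewrite trmxK trmx0.
Qed.

(* The rows of W W^T and of W^T span the same space, since both have the rank of W. *)
Lemma orthogonal_residual m n (W : 'M[R]_(m, n)) (v : 'rV[R]_n) :
  exists a : 'rV[R]_m, (v - a *m W) *m W^T = 0.
Proof.
have sub : (W^T <= W *m W^T)%MS.
  have [_ <-] := mxrank_leqif_sup (submxMl W W^T); rewrite mxrank_tr.
  have kerE : (kermx (W *m W^T) <= kermx W)%MS.
    apply/row_subP => i; apply/sub_kermxP; set u := row i _.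
    have uWW : u *m (W *m W^T) = 0 by apply/sub_kermxP; exact: row_sub.
    apply: tr_mul_eq0_rV; rewrite trmx_mul mulmxA -(mulmxA u).
    by rewrite uWW mul0mx.
  rewrite eqn_leq mxrankM_maxl /=.
  have := mxrankS kerE; rewrite !mxrank_ker.
  by rewrite leq_sub2lE ?rank_leq_row.
have /submxP[a aE] : (v *m W^T <= W *m W^T)%MS by exact: submx_trans (submxMl _ _) sub.
by exists a; rewrite mulmxBl aE mulmxA subrr.
Qed.

(** Gram-Schmidt from the last rank downwards: row [k] of [O] is the normalised residual of column
    [k] of [J] after projection onto the columns of larger rank. *)
Lemma orthogonal_triangularisation p (J : 'M[R]_p) (s : 'I_p -> nat) :
  injective s -> J \in unitmx ->
  exists O : 'M[R]_p, [/\ O^T *m O = 1%:M,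
    (forall k l, (s k < s l)%N -> (O *m J) k l = 0) & (forall k, 0 < (O *m J) k k)].
Proof.
move=> sinj uJ.
have /choice[a aP] : forall k, exists a : 'rV[R]_p,
    let W := \matrix_(l, j) (if (s k < s l)%N then J j l else 0) in
    ((col k J)^T - a *m W) *m W^T = 0.
  by move=> k; exact: orthogonal_residual.
(* [b k] holds the coefficients of the residual in the columns of [J]: 1 at [k], and otherwise
   supported on later columns. *)
pose b k : 'rV[R]_p := \row_l ((l == k)%:R - (if (s k < s l)%N then a k 0 l else 0)).
pose res k := b k *m J^T.
have resE k : res k = (col k J)^T - a k *m \matrix_(l, j) (if (s k < s l)%N then J j l else 0).
  apply/rowP => j; rewrite !mxE (eq_bigr (fun l => (l == k)%:R * J j l -
      a k 0 l * (\matrix_(l, j) (if (s k < s l)%N then J j l else 0) : 'M[R]_p) l j)).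
    rewrite sumrB (bigD1 k)//= eqxx mul1r big1 ?addr0// => l /negbTE ->.
    by rewrite mul0r.
  by move=> l _; rewrite !mxE mulrBl; case: ifP => _; rewrite ?mul0r ?mulr0.
have resJ k l : (s k < s l)%N -> (res k *m J) 0 l = 0.
  move=> kl; have /(congr1 (fun M : 'rV[R]_p => M 0 l)) := aP k.
  rewrite -resE [RHS]mxE => <-; rewrite !mxE; apply: eq_bigr => j _.
  by rewrite !mxE kl.
have bk k : b k 0 k = 1 by rewrite mxE eqxx ltnn subr0.
(* The columns of [J] are independent and the residual has coefficient 1 on column [k]. *)
have res0 k : res k != 0.
  apply/eqP => /(congr1 (mulmx^~ (invmx J^T))).
  rewrite /= /res mulmxK ?unitmx_tr// mul0mx => /(congr1 (fun M : 'rV[R]_p => M 0 k)).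
  by rewrite bk mxE => /eqP; rewrite oner_eq0.
have dot k l : (res k *m (res l)^T) 0 0 = \sum_i (res k *m J) 0 i * b l 0 i.
  rewrite {2}/res trmx_mul trmxK mulmxA [LHS]mxE.
  by apply: eq_bigr => i _; rewrite [_^T _ _]mxE.
have dot0 k l : (s k < s l)%N -> (res k *m (res l)^T) 0 0 = 0.
  move=> kl; rewrite dot big1// => i _.
  have [->|il] := eqVneq i l; first by rewrite resJ ?mul0r.
  rewrite [b l 0 i]mxE (negbTE il); case: ifP => li; last by rewrite subr0 mulr0.
  by rewrite resJ ?mul0r// (ltn_trans kl).
(* The residual is orthogonal to the later columns, so only its own column contributes; this makes
   the diagonal of [O *m J] positive. *)
have dotk k : (res k *m (res k)^T) 0 0 = (res k *m J) 0 k.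
  rewrite dot (bigD1 k)//= bk mulr1 big1 ?addr0// => i ik.
  rewrite [b k 0 i]mxE (negbTE ik); case: ifP => ki; last by rewrite subr0 mulr0.
  by rewrite resJ ?mul0r.
have nrm_gt0 k : 0 < (res k *m (res k)^T) 0 0.
  rewrite lt0r; apply/andP; split.
    apply: contra (res0 k) => /eqP h; apply/eqP/tr_mul_eq0_rV.
    by apply/matrixP => i j; rewrite !ord1 h mxE.
  by rewrite mxE sumr_ge0// => i _; rewrite [X in _ * X]mxE -expr2 sqr_ge0.
pose nrm k := Num.sqrt ((res k *m (res k)^T) 0 0).
have nrm0 k : 0 < nrm k by rewrite sqrtr_gt0.
pose O : 'M[R]_p := \matrix_(k, j) ((nrm k)^-1 * res k 0 j).
have OJ k l : (O *m J) k l = (nrm k)^-1 * (res k *m J) 0 l.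
  by rewrite !mxE mulr_sumr; apply: eq_bigr => j _; rewrite mxE mulrA.
exists O; split.
- apply: mulmx1C; apply/matrixP => k l.
  have -> : (O *m O^T) k l = (nrm k)^-1 * (nrm l)^-1 * (res k *m (res l)^T) 0 0.
    rewrite !mxE mulr_sumr; apply: eq_bigr => j _; rewrite !mxE; ring.
  rewrite [RHS]mxE; have [<-|kl] := eqVneq k l.
    by rewrite -(sqr_sqrtr (ltW (nrm_gt0 k))) -/(nrm k) mulr1n; field; exact: lt0r_neq0.
  have [skl|] := ltnP (s k) (s l); first by rewrite dot0// mulr0.
  rewrite leq_eqVlt => /orP[/eqP /sinj lk|slk]; first by rewrite lk eqxx in kl.
  rewrite -[res k *m _]trmxK trmx_mul trmxK [_^T _ _]mxE dot0// mulr0//.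
- by move=> k l kl; rewrite OJ resJ ?mulr0.
- by move=> k; rewrite OJ -dotk mulr_gt0// invr_gt0.
Qed.

End Orthogonal.

(** * Densities and second derivatives of PLSEMs *)

Section Plsem.
Context {R : realType} {p : nat}.
Implicit Types (M : plsem R p) (x : 'rV[R]_p).

(** The number of ancestors, each vertex counting itself, strictly increases along an edge; ties are
    broken by the index, the pair being written in base [p]. *)
Lemma acyclic_rank (D : rel 'I_p) : acyclic D ->
  exists2 r : 'I_p -> nat, injective r & forall i j, D i j -> (r i < r j)%N.
Proof.
move=> acD; pose r0 i := #|[pred k | connect D k i]|.
exists (fun i => r0 i * p + i)%N.
  move=> i j /(congr1 (modn^~ p)) /=.
  by rewrite !modnMDl !modn_small ?ltn_ord// => /val_inj.
move=> i j Dij; have r0ij : (r0 i < r0 j)%N.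
  apply: proper_card; apply/properP; split.
    apply/fintype.subsetP => k; rewrite !inE => ki; exact: connect_trans ki (connect1 Dij).
  by exists j; rewrite !inE ?connect0// acD.
apply: (@leq_trans (r0 i * p + p)); first by rewrite ltn_add2l.
by rewrite -mulSnr (leq_trans _ (leq_addr _ _))// leq_mul2r r0ij orbT.
Qed.

Lemma acyclic_of_rank (D : rel 'I_p) (r : 'I_p -> nat) :
  (forall i j, D i j -> (r i < r j)%N) -> acyclic D.
Proof.
move=> rD i j Dij; apply/negP => /connectP[l + li].
have : forall k, path D k l -> (r k <= r (last k l))%N.
  elim: l {li} => //= a l IH k /andP[/rD ka /IH]; exact: leq_trans (ltnW ka).
by move=> /[apply]; rewrite -li leqNgt rD.
Qed.

(** The constant [mu M j] is put into the diagonal curve, so that [plsem_fun M] is exactly the sum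
    of these curves. *)
Definition plsem_col M (j i : 'I_p) (t : R) : R :=
  (sd M j)^-1 * ((if i == j then t - mu M j else 0) - (if dag M i j then fn M j i t else 0)).
Definition plsem_col1 M (j i : 'I_p) (t : R) : R :=
  (sd M j)^-1 * ((i == j)%:R - (if dag M i j then derive1 (fn M j i) t else 0)).
Definition plsem_col2 M (j i : 'I_p) (t : R) : R :=
  (sd M j)^-1 * (- (if dag M i j then derive1 (derive1 (fn M j i)) t else 0)).

Lemma plsem_funE M : plsem_fun M = additive_map (plsem_col M).
Proof.
apply/funext => x; apply/rowP => j; rewrite !mxE -mulr_sumr sumrB.
by rewrite -!big_mkcond big_pred1_eq.
Qed.

Lemma is_derive_plsem_col M j i t : plsem_wf M ->
  is_derive t (1 : R) (plsem_col M j i) (plsem_col1 M j i t).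
Proof.
move=> [_ _ wf].
have h1 : is_derive t (1 : R) (fun t => if i == j then t - mu M j else 0) (i == j)%:R.
  case: eqP => _; last exact: is_derive_cst.
  by apply: is_derive_eq; rewrite subr0.
have h2 : is_derive t (1 : R) (fun t => if dag M i j then fn M j i t else 0)
    (if dag M i j then derive1 (fn M j i) t else 0).
  case: ifPn => [/wf[[df _] _]|_]; last exact: is_derive_cst.
  by split; [exact: df|rewrite derive1E].
apply: (is_derive_ext (f := (sd M j)^-1 \*: ((fun t => if i == j then t - mu M j else 0) -
  (fun t => if dag M i j then fn M j i t else 0)))) => //.
Qed.

Lemma is_derive_plsem_col1 M j i t : plsem_wf M ->
  is_derive t (1 : R) (plsem_col1 M j i) (plsem_col2 M j i t).
Proof.
move=> [_ _ wf].
have h2 : is_derive t (1 : R) (fun t => if dag M i j then derive1 (fn M j i) t else 0)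
    (if dag M i j then derive1 (derive1 (fn M j i)) t else 0).
  case: ifPn => [/wf[[_ [df _]] _]|_]; last exact: is_derive_cst.
  by split; [exact: df|rewrite [RHS]derive1E].
apply: (is_derive_ext (f := (sd M j)^-1 \*: (cst (i == j)%:R -
  (fun t => if dag M i j then derive1 (fn M j i) t else 0)))) => //.
by apply: is_derive_eq; rewrite sub0r.
Qed.

Lemma is_derive_continuous (f df : R -> R) :
  (forall t, is_derive t (1 : R) f (df t)) -> continuous f.
Proof.
move=> h t; apply/differentiable_continuous/derivable1_diffP.
by have [] := h t.
Qed.

Lemma continuous_plsem_col M j i : plsem_wf M -> continuous (plsem_col M j i).
Proof. by move=> wf; apply: is_derive_continuous => t; exact: is_derive_plsem_col. Qed.

Definition plsem_jac M x : 'M[R]_p := \matrix_(j, k) plsem_col1 M j k (x 0 k).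

(* Entry j is the paper's e_j^t (DF)^{-1} d_i^2 F. *)
Definition plsem_coeff M x i : 'cV[R]_p :=
  invmx (plsem_jac M x) *m \col_j plsem_col2 M j i (x 0 i).

Lemma VsetP M i j : plsem_wf M ->
  Vset M (i, j) <-> exists x, plsem_coeff M x i j 0 != 0.
Proof.
move=> wf; rewrite /Vset /=.
have E x : invmx (Defs.jacobian (plsem_fun M) x) *m (second_partial (plsem_fun M) i x)^T =
    plsem_coeff M x i.
  have d1 j' i' t := is_derive_plsem_col j' i' t wf.
  have d2 j' i' t := is_derive_plsem_col1 j' i' t wf.
  rewrite plsem_funE (jacobian_additive d1) (second_partial_additive d1 d2).
  by congr (_ *m _); apply/colP => k; rewrite !mxE.
by split=> -[x]; [rewrite E|rewrite -E] => h; exists x.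
Qed.

Section Ranked.
Variables (M : plsem R p) (r : 'I_p -> nat).
Hypotheses (wf : plsem_wf M) (rD : forall i j, dag M i j -> (r i < r j)%N).

Let sd_neq0 j : sd M j != 0. Proof. by case: wf => _ /(_ j)/lt0r_neq0. Qed.

Let jac_diag x j : plsem_jac M x j j != 0.
Proof.
rewrite mxE /plsem_col1 eqxx; have -> : dag M j j = false.
  by apply/negP => /rD; rewrite ltnn.
by rewrite subr0 mulr1 invr_neq0.
Qed.

Let jac_tri x j k : k != j -> ~~ (r k < r j)%N -> plsem_jac M x j k = 0.
Proof.
move=> kj; rewrite mxE /plsem_col1 (negbTE kj).
by case: ifPn => [/rD -> //|_ _]; rewrite subr0 mulr0.
Qed.

Lemma plsem_jac_unit x : plsem_jac M x \in unitmx.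
Proof. exact: (triangular_unitmx (jac_diag x) (jac_tri x)). Qed.

Lemma plsem_jac_coeff x i :
  plsem_jac M x *m plsem_coeff M x i = \col_j plsem_col2 M j i (x 0 i).
Proof. by rewrite mulKVmx// plsem_jac_unit. Qed.

Lemma plsem_coeff_eq0 x i j : ~~ (r i < r j)%N -> plsem_coeff M x i j 0 = 0.
Proof.
rewrite -leqNgt; apply: (triangular_solution_eq0 (jac_diag x) (jac_tri x)) => k rk.
rewrite plsem_jac_coeff mxE /plsem_col2; case: ifPn => [/rD|_].
  by rewrite ltnNge rk.
by rewrite oppr0 mulr0.
Qed.

(* [triangular (innovation_shift N)] recovers the noise vector from the observed one. *)
Definition innovation_shift (N : plsem R p) (j : 'I_p) (x : p.-tuple R) : R :=
  - mu N j - \sum_(i | dag N i j) fn N j i (tnth x i).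

Lemma innovation_volume : injective r ->
  let E := triangular (innovation_shift M) in
  [/\ measurable_fun setT E,
      (exists2 H, measurable_fun setT H & cancel E H) &
      forall A, measurable A -> tuple_leb p (E @^-1` A) = tuple_leb p A].
Proof.
move=> rinj; apply: (tuple_leb_triangular rinj).
  move=> j; apply: measurable_funB; first exact: measurable_cst.
  under eq_fun do rewrite big_mkcond.
  apply: measurable_sum => i; case: (boolP (dag M i j)) => Dij; last exact: measurable_cst.
  apply: measurableT_comp; last exact: measurable_tnth.
  apply: continuous_measurable_fun => t.
  have [[df _] _] := (let: And3 _ _ h := wf in h) _ _ Dij.
  exact/differentiable_continuous/derivable1_diffP.
move=> j x y xy; congr (_ - _); apply: eq_bigr => i Dij.
by rewrite xy// rD.
Qed.

End Ranked.

Definition sqnorm M x : R := \sum_j plsem_fun M x 0 j ^+ 2.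

Definition gauss_const M : R := \prod_(j < p) normal_peak (sd M j).

Lemma gauss_const_gt0 M : plsem_wf M -> 0 < gauss_const M.
Proof.
move=> [_ sd0 _]; apply: prodr_gt0 => j _.
by apply: normal_peak_gt0; rewrite gt_eqF.
Qed.

(** The [j]-th innovation is [sd M j] times the [j]-th component of [plsem_fun M], so the Gaussian
    exponents add up to the squared norm. *)
Lemma gauss_density_innovation M (x : p.-tuple R) : plsem_wf M ->
  gauss_density (sd M) (triangular (innovation_shift M) x) =
  gauss_const M * expR (- sqnorm M (rv_of_tuple x) / 2).
Proof.
move=> [_ sd0 _]; rewrite /sqnorm mulNr mulr_suml -sumrN expR_sum -big_split /=.
apply: eq_bigr => j _; have s0 := lt0r_neq0 (sd0 j).
rewrite normal_pdfE// /normal_fun tnth_mktuple !mxE; congr (_ * expR _).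
under [in RHS]eq_bigr do rewrite mxE.
rewrite /innovation_shift; set S := \sum_(i | _) _; rewrite mulNr.
by field.
Qed.

Lemma continuous_sum (T : topologicalType) (I : finType) (F : I -> T -> R) :
  (forall i, continuous (F i)) -> continuous (fun z => \sum_i F i z).
Proof.
move=> cF; elim: (index_enum I) => [|i l IH] z.
  by under eq_fun do rewrite big_nil; exact: cvg_cst.
by under eq_fun do rewrite big_cons; apply: cvgD; [exact: cF|exact: IH].
Qed.

Lemma continuous_sqnorm M : plsem_wf M -> continuous (sqnorm M).
Proof.
move=> wf; rewrite /sqnorm plsem_funE.
apply: continuous_sum => j x; apply: (cvg_comp (fun z => additive_map (plsem_col M) z 0 j) (fun t : R => t ^+ 2));
  last exact: exprn_continuous.
apply: (_ : continuous (fun x => additive_map (plsem_col M) x 0 j)) x.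
rewrite (_ : (fun z => _) = fun x : 'rV[R]_p => \sum_i plsem_col M j i (x 0 i)).
  apply: continuous_sum => i z.
  apply: (cvg_comp (fun y : 'rV[R]_p => y 0 i) (plsem_col M j i)).
    exact: coord_continuous.
  exact: continuous_plsem_col.
by apply/funext => x; rewrite mxE.
Qed.

Lemma measurable_sqnorm M : plsem_wf M -> measurable_fun setT (sqnorm M \o @rv_of_tuple R p).
Proof.
move=> wf; rewrite (_ : _ \o _ = fun x : p.-tuple R =>
    \sum_j (\sum_i plsem_col M j i (tnth x i)) ^+ 2).
  apply: measurable_sum => j; apply: measurable_funX; apply: measurable_sum => i.
  have mcol := continuous_measurable_fun (@continuous_plsem_col M j i wf).
  exact: (measurableT_comp mcol (measurable_tnth i)).
apply/funext => x; rewrite /= /sqnorm plsem_funE; apply: eq_bigr => j _.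
by rewrite mxE; congr (_ ^+ 2); apply: eq_bigr => i _; rewrite mxE.
Qed.

End Plsem.

(** * Comparison of two PLSEMs generating the same law *)

Section Generates.
Context {R : realType} {p : nat}.
Variable P : probability (p.-tuple R) R.
Implicit Types (M : plsem R p).

Lemma generates_density M : generates P M -> forall A, measurable A ->
  P A = (\int[tuple_leb p]_(x in A)
           (gauss_const M * expR (- sqnorm M (rv_of_tuple x) / 2))%:E)%E.
Proof.
move=> [wf [d [U [Q [X [eps [[meps mX] ind law [eqX _] PX]]]]]]] A mA.
have [acD _ _] := wf; have [r rinj rD] := acyclic_rank acD.
have [mE Einv volE] := innovation_volume wf rD rinj.
under eq_integral do rewrite -gauss_density_innovation//.
apply: (gauss_pushforward_density mE Einv volE) => // B mB.
have mEB : measurable (triangular (innovation_shift M) @^-1` box B).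
  by rewrite -[X in measurable X]setTI; apply: mE => //; exact: measurable_box.
rewrite -[LHS](PX _ mEB).
have EX j w : tnth (triangular (innovation_shift M) [tuple X i w | i < p]) j = eps j w.
  rewrite /triangular tnth_mktuple /innovation_shift.
  under eq_bigr do rewrite tnth_mktuple.
  by rewrite tnth_mktuple eqX; ring.
(* The innovations of the observed vector are the noise variables by [EX]; independence is applied
   to the full index set. *)
transitivity (Q (\bigcap_(j in [set j | j \in [set: 'I_p]%SET]) (eps j @^-1` B j))).
  congr (Q _); apply/seteqP; split => w /= h j.
    by move=> _ /=; rewrite -EX; exact: h.
  by rewrite EX; apply: h; rewrite /= finset.in_setT.
rewrite ind//; apply: eq_big => [j|j _]; first by rewrite finset.in_setT.
exact: law.
Qed.

Lemma generates_sqnorm M M' : generates P M -> generates P M' ->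
  exists c, forall x, sqnorm M x = sqnorm M' x + c.
Proof.
move=> gM gM'; have wf := gM.1; have wf' := gM'.1.
have C0 := gauss_const_gt0 wf; have C0' := gauss_const_gt0 wf'.
pose u (N : plsem R p) (x : 'rV[R]_p) : R := gauss_const N * expR (- sqnorm N x / 2).
have cu N : plsem_wf N -> continuous (u N).
  move=> wN x; apply: (cvg_comp (sqnorm N) (fun t : R => gauss_const N * expR (- t / 2))).
    exact: continuous_sqnorm.
  apply: cvgM; first exact: cvg_cst.
  apply: (cvg_comp _ expR); last exact: continuous_expR.
  apply: cvgM; last exact: cvg_cst.
  by apply: (@cvgN _ R^o); exact: cvg_id.
have mu N : plsem_wf N -> measurable_fun setT (u N \o @rv_of_tuple R p).
  move=> wN; apply: measurable_funM => //; apply: measurableT_comp => //.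
  apply: measurable_funM => //; apply: measurableT_comp => //.
  exact: measurable_sqnorm.
have u0 N : plsem_wf N -> forall x, 0 <= u N x.
  by move=> wN x; rewrite mulr_ge0 ?expR_ge0// ltW// gauss_const_gt0.
have uu x : u M x = u M' x.
  apply/eqP; rewrite eq_le; apply/andP; split.
    apply: (continuous_density_le (cu M wf) (cu M' wf') (mu M wf) (mu M' wf')
      (u0 M wf) (u0 M' wf')) => A mA.
    by rewrite -(generates_density gM mA) -(generates_density gM' mA).
  apply: (continuous_density_le (cu M' wf') (cu M wf) (mu M' wf') (mu M wf)
      (u0 M' wf') (u0 M wf)) => A mA.
  by rewrite -(generates_density gM mA) -(generates_density gM' mA).
(* Taking logarithms of the two equal densities leaves twice the difference of the log normalising
   constants. *)
exists (ln (gauss_const M) *+ 2 - ln (gauss_const M') *+ 2) => x.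
have := congr1 (@ln R) (uu x).
rewrite /u !lnM ?posrE ?expR_gt0// !expRK; lra.
Qed.

(** An instance of [same_solutions] with the Jacobians as [A] and [B]. The order [s] belongs to
    [M']; the order [r] of [M] gives invertibility and the zero entries [c i i 0]. *)
Lemma generates_coeff_eq M M' (s : 'I_p -> nat) : generates P M -> generates P M' ->
  (forall i j, dag M' i j -> (s i < s j)%N) ->
  forall x i, plsem_coeff M x i = plsem_coeff M' x i.
Proof.
move=> gM gM' sD x; have [c cE] := generates_sqnorm gM gM'.
have wf := gM.1; have wf' := gM'.1.
have [acD _ _] := wf; have [r rinj rD] := acyclic_rank acD.
have d1 j' i' t := is_derive_plsem_col j' i' t wf.
have d2 j' i' t := is_derive_plsem_col1 j' i' t wf.
have e1 j' i' t := is_derive_plsem_col j' i' t wf'.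
have e2 j' i' t := is_derive_plsem_col1 j' i' t wf'.
have eqn y : \sum_j additive_map (plsem_col M) y 0 j ^+ 2 =
    \sum_j additive_map (plsem_col M') y 0 j ^+ 2 + c.
  by rewrite -!plsem_funE; exact: cE.
have entry (A : 'M[R]_p) (b : 'cV[R]_p) k : (A^T *m b) k 0 = \sum_j b j 0 * A j k.
  by rewrite mxE; apply: eq_bigr => j _; rewrite mxE mulrC.
have gramE (A : 'M[R]_p) i k : (A^T *m A) i k = \sum_j A j i * A j k.
  by rewrite mxE; apply: eq_bigr => j _; rewrite mxE.
have dotE (f : 'rV[R]_p) (w : 'I_p -> R) :
    (f^T^T *m \col_j w j) 0 0 = \sum_j f 0 j * w j.
  by rewrite trmxK mxE; apply: eq_bigr => j _; rewrite [X in _ * X]mxE.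
apply: (@same_solutions R p (plsem_jac M x) (plsem_jac M' x) s (\max_i s i).+1
  (plsem_coeff M x) (plsem_coeff M' x)
  (additive_map (plsem_col M) x)^T (additive_map (plsem_col M') x)^T).
- exact: plsem_jac_unit rD _.
- by move=> i; rewrite ltnS leq_bigmax.
- move=> i k ik; have /= := gram_offdiag_eq d1 e1 eqn x ik; rewrite !gramE => h.
  under eq_bigr do rewrite !mxE mulrC; under [in RHS]eq_bigr do rewrite !mxE mulrC.
  exact: h.
- move=> i k ik; rewrite (plsem_jac_coeff wf rD) (plsem_jac_coeff wf' sD).
  rewrite [LHS]entry [RHS]entry.
  transitivity (\sum_j plsem_col2 M j i (x 0 i) * plsem_col1 M j k (x 0 k)).
    by apply: eq_bigr => j _; rewrite [plsem_jac _ _ _ _]mxE [X in X * _]mxE.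
  rewrite (gram_second_eq d1 d2 e1 e2 eqn x ik).
  by apply: eq_bigr => j _; rewrite [plsem_jac _ _ _ _]mxE [X in _ = X * _]mxE.
- apply/colP => i; rewrite [LHS]entry [RHS]entry.
  transitivity (\sum_j additive_map (plsem_col M) x 0 j * plsem_col1 M j i (x 0 i)).
    by apply: eq_bigr => j _; rewrite [plsem_jac _ _ _ _]mxE [X in X * _]mxE.
  rewrite (norm_grad_eq d1 e1 eqn x i).
  by apply: eq_bigr => j _; rewrite [plsem_jac _ _ _ _]mxE [X in _ = X * _]mxE.
- move=> i; rewrite (plsem_jac_coeff wf rD) (plsem_jac_coeff wf' sD) !gramE.
  rewrite [X in _ + X]dotE [X in _ = _ + X]dotE -!big_split /=.
  transitivity (\sum_j (plsem_col1 M j i (x 0 i) * plsem_col1 M j i (x 0 i) +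
      additive_map (plsem_col M) x 0 j * plsem_col2 M j i (x 0 i))).
    by apply: eq_bigr => j _; rewrite ![plsem_jac _ _ _ _]mxE.
  rewrite (gram_diag_eq d1 d2 e1 e2 eqn x i).
  by apply: eq_bigr => j _; rewrite ![plsem_jac _ _ _ _]mxE.
- by move=> i; rewrite (plsem_coeff_eq0 wf rD)// ltnn.
- by move=> i k; exact: plsem_coeff_eq0.
Qed.

(** A coefficient of [M] that is nonzero at some point is also one of [M'], and triangularity allows
    those only upwards along [s]. *)
Lemma generates_Vset_lt M M' (s : 'I_p -> nat) : generates P M -> generates P M' ->
  (forall i j, dag M' i j -> (s i < s j)%N) ->
  forall i j, Vset M (i, j) -> (s i < s j)%N.
Proof.
move=> gM gM' sD i j /(VsetP _ _ gM.1)[x]; rewrite (generates_coeff_eq gM gM' sD).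
by apply: contraR => /(plsem_coeff_eq0 gM'.1 sD) ->.
Qed.

End Generates.

(** * First moment of the normal distribution *)

Section IntegralDensity.
Context {R : realType} {d} {T : measurableType d}.
Variables (mu nu : {measure set T -> \bar R}) (f : T -> R).
Hypotheses (mf : measurable_fun setT f) (f0 : forall x, 0 <= f x).
Hypothesis nuE : forall A, measurable A -> nu A = (\int[mu]_(x in A) (f x)%:E)%E.
Local Open Scope ereal_scope.

Import HBNNSimple.

Let integral_density_nnsfun (h : {nnsfun T >-> R}) :
  \int[nu]_x (h x)%:E = \int[mu]_x ((h x)%:E * (f x)%:E).
Proof.
under [LHS]eq_integral do rewrite fimfunE -fsumEFin//.
rewrite [LHS]ge0_integral_fsum//; last 2 first.
  - by move=> r; exact/measurable_EFinP/measurableT_comp.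
  - by move=> n x _; rewrite EFinM nnfun_muleindic_ge0.
under [RHS]eq_integral.
  move=> x xD; rewrite fimfunE -fsumEFin// ge0_mule_fsuml; last first.
    by move=> r; rewrite EFinM nnfun_muleindic_ge0.
  over.
rewrite [RHS]ge0_integral_fsum//; last 2 first.
  - move=> r; apply: emeasurable_funM; last exact/measurable_EFinP.
    by apply/measurable_EFinP; do 2 apply/measurableT_comp => //.
  - move=> n x _; apply: mule_ge0; last by rewrite lee_fin.
    by rewrite EFinM nnfun_muleindic_ge0.
apply: eq_fsbigr => r _.
have [r0|r0] := ltP r 0%R.
  rewrite preimage_nnfun0//.
  by rewrite !integral0_eq// => x _; rewrite indic0 mulr0 ?mul0e.
rewrite integralZl_indic_nnsfun// integral_indic// setIT nuE//.
under [RHS]eq_integral do rewrite EFinM -muleA.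
rewrite ge0_integralZl//; last 2 first.
  - apply: emeasurable_funM; last exact/measurable_EFinP.
    exact/measurable_EFinP/measurable_indic.
  - by move=> x _; rewrite mule_ge0 ?lee_fin.
congr (_ * _); rewrite integral_mkcond; apply: eq_integral => x _.
by rewrite patchE indicE; case: ifP => _; rewrite ?mul1e ?mul0e.
Qed.

(** The identity holds for simple functions and passes to increasing limits by monotone
    convergence. *)
Lemma ge0_integral_density (g : T -> \bar R) :
  measurable_fun setT g -> (forall x, 0 <= g x) ->
  \int[nu]_x g x = \int[mu]_x (g x * (f x)%:E).
Proof.
move=> mg g0; pose g_ := nnsfun_approx measurableT mg.
have gE x : (g_ n x)%:E @[n --> \oo]%classic --> g x by exact: cvg_nnsfun_approx.
transitivity (limn (fun n => \int[nu]_x (g_ n x)%:E)).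
  rewrite -monotone_convergence//=.
  - by apply: eq_integral => x _; apply/esym/cvg_lim.
  - by move=> n; exact/measurable_EFinP.
  - by move=> n x _; rewrite lee_fin.
  - by move=> x _ m n mn; rewrite lee_fin; exact/lefP/nd_nnsfun_approx.
transitivity (limn (fun n => \int[mu]_x ((g_ n x)%:E * (f x)%:E))).
  by congr (limn _); apply/funext => n; exact: integral_density_nnsfun.
rewrite -monotone_convergence//=.
- apply: eq_integral => x _; apply/cvg_lim => //.
  by apply: cvgeZr.
- by move=> n; apply: emeasurable_funM; exact/measurable_EFinP.
- by move=> n x _; rewrite mule_ge0 ?lee_fin.
- move=> x _ m n mn; rewrite lee_wpmul2r ?lee_fin//.
  exact/lefP/nd_nnsfun_approx.
Qed.

End IntegralDensity.

Section NormalIntegrable.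
Context {R : realType}.

(* |t| is bounded by the ratio of the Gaussian weights of parameters 2 s and s,
   up to a constant. *)
Lemma normal_first_moment (s : R) : 0 < s ->
  (\int[normal_prob 0 s]_t `|t|%:E < +oo)%E.
Proof.
move=> s0; have sn0 : s != 0 by rewrite gt_eqF.
have s20 : s *+ 2 != 0 by rewrite mulrn_eq0.
have mabs : measurable_fun [set: R] (fun t : R => `|t|%:E).
  by apply/measurable_EFinP; exact: normr_measurable.
have mpdf s' : measurable_fun [set: R] (fun t : R => (normal_pdf 0 s' t)%:E).
  by apply/measurable_EFinP; exact: measurable_normal_pdf.
rewrite (ge0_integral_density (mu := lebesgue_measure) (measurable_normal_pdf 0 s)
  (normal_pdf_ge0 0 s) _ mabs)//.
pose c : R := normal_peak s / normal_peak (s *+ 2) * (1 + s ^+ 2 *+ 8).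
have c0 : 0 <= c.
  by rewrite /c !mulr_ge0 ?invr_ge0 ?normal_peak_ge0// addr_ge0// mulrn_wge0// sqr_ge0.
apply: (@le_lt_trans _ _ (\int[lebesgue_measure]_t (c%:E * (normal_pdf 0 (s *+ 2) t)%:E))%E).
  apply: ge0_le_integral => //.
  - by move=> t _; rewrite mule_ge0 ?lee_fin ?normal_pdf_ge0.
  - exact: (emeasurable_funM mabs (mpdf s)).
  - exact: (measurable_funeM c%:E (mpdf _)).
  - move=> t _; rewrite -!EFinM lee_fin !normal_pdfE// /normal_fun !subr0.
    have pk0 := normal_peak_gt0 s20; have pk1 := normal_peak_gt0 sn0.
    set E2 := expR (- t ^+ 2 / ((s *+ 2) ^+ 2 *+ 2)).
    have e20 : 0 < E2 by exact: expR_gt0.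
    have -> : c * (normal_peak (s *+ 2) * E2) = normal_peak s * ((1 + s ^+ 2 *+ 8) * E2).
      by rewrite /c; field; exact: lt0r_neq0.
    rewrite mulrCA ler_pM2l//.
    (* [q] is the gap between the exponents: [t^2/(2 s^2) = t^2/(8 s^2) + 3 t^2/(8 s^2)]. *)
    pose q := t ^+ 2 / (s ^+ 2 *+ 8) *+ 3.
    have -> : expR (- t ^+ 2 / (s ^+ 2 *+ 2)) = E2 * expR (- q).
      by rewrite /E2 -expRD /q; congr expR; field.
    have q0 : 0 <= t ^+ 2 / (s ^+ 2 *+ 8) by rewrite divr_ge0 ?mulrn_wge0// sqr_ge0.
    rewrite mulrCA [leRHS]mulrC ler_pM2l// expRN ler_pdivrMr ?expR_gt0//.
    have eq : 1 + q <= expR q by exact: expR_ge1Dx.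
    (* The expanded product contains [1 + t^2], which dominates [|t|]; this is the origin of the
       factor [1 + 8 s^2] in [c]. *)
    have tq : `|t| <= (1 + s ^+ 2 *+ 8) * (1 + t ^+ 2 / (s ^+ 2 *+ 8)).
      have -> : (1 + s ^+ 2 *+ 8) * (1 + t ^+ 2 / (s ^+ 2 *+ 8)) =
          1 + s ^+ 2 *+ 8 + t ^+ 2 / (s ^+ 2 *+ 8) + t ^+ 2 by field.
      have := sqr_ge0 (`|t| - 1); rewrite sqrrB1 real_normK ?num_real// => h1.
      have h2 := sqr_ge0 s; have h3 := sqr_ge0 t; lra.
    apply: (le_trans tq); rewrite ler_wpM2l//.
      by rewrite addr_ge0// mulrn_wge0// sqr_ge0.
    by apply: le_trans eq; rewrite /q; lra.
rewrite ge0_integralZl//=; first by rewrite integral_normal_pdf mule1 ltry.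
- exact: mpdf.
- by move=> t _; rewrite lee_fin normal_pdf_ge0.
Qed.

Lemma normal_integrable d (W : measurableType d) (Q : probability W R) (e : W -> R) s :
  measurable_fun setT e -> 0 < s ->
  (forall B : set R, measurable B -> Q (e @^-1` B) = normal_prob 0 s B) ->
  Q.-integrable setT (EFin \o e).
Proof.
move=> me s0 law; apply/integrableP; split; first exact/measurable_EFinP.
rewrite (_ : (\int[Q]_x _)%E = (\int[normal_prob 0 s]_t `|t|%:E)%E).
  exact: normal_first_moment.
have mabs : measurable_fun [set: R] (fun t : R => `|t|%:E).
  by apply/measurable_EFinP; exact: normr_measurable.
pose e' : W -> measurableTypeR R := e; have me' : measurable_fun setT e' by exact: me.
have := @ge0_integral_pushforward _ _ _ _ R e' me' Q setT (fun t => `|t|%:E) measurableT mabs.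
rewrite preimage_setT => <-; last by move=> t _.
by apply: eq_measure_integral => A mA _; exact: law.
Qed.

End NormalIntegrable.

(** * Rotating a PLSEM *)

Section Rotation.
Context {R : realType} {p : nat}.
Variables (M : plsem R p) (r s : 'I_p -> nat) (O : 'M[R]_p) (m : 'I_p -> 'I_p -> R).
Hypotheses (wf : plsem_wf M) (rD : forall i j, dag M i j -> (r i < r j)%N).
Hypotheses (sinj : injective s) (sV : forall i j, Vset M (i, j) -> (s i < s j)%N).
Hypotheses (OO : O^T *m O = 1%:M)
  (Otri : forall k l, (s k < s l)%N -> (O *m plsem_jac M 0) k l = 0)
  (Opos : forall k, 0 < (O *m plsem_jac M 0) k k).

(** Multiplication by [O] acts on each curve separately, so a rotated sum of curves is again one. *)
Definition mix (K : 'I_p -> 'I_p -> R -> R) (k l : 'I_p) (t : R) : R :=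
  \sum_j O k j * K j l t.

Let G := mix (plsem_col M).
Let G1 := mix (plsem_col1 M).
Let G2 := mix (plsem_col2 M).

Let is_derive_mix K K1 k l t : (forall j, is_derive t (1 : R) (K j l) (K1 j l t)) ->
  is_derive t (1 : R) (mix K k l) (mix K1 k l t).
Proof.
by move=> h; exact: is_derive_sum_fun.
Qed.

Let dG k l t : is_derive t (1 : R) (G k l) (G1 k l t).
Proof. by apply: is_derive_mix => j; exact: is_derive_plsem_col. Qed.

Let dG1 k l t : is_derive t (1 : R) (G1 k l) (G2 k l t).
Proof. by apply: is_derive_mix => j; exact: is_derive_plsem_col1. Qed.

Let G1E x k l : (O *m plsem_jac M x) k l = G1 k l (x 0 l).
Proof. by rewrite mxE; apply: eq_bigr => j _; rewrite mxE. Qed.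

Let alpha k : R := G1 k k 0.

Let alpha_gt0 k : 0 < alpha k.
Proof. by have := Opos k; rewrite G1E mxE. Qed.

Let coeff0 x i j : ~~ (s i < s j)%N -> plsem_coeff M x i j 0 = 0.
Proof.
move=> ij; apply/eqP; apply: contraNT ij => h; apply: sV.
by apply/VsetP => //; exists x.
Qed.

(* The second derivative of column i is a combination of the first derivatives of the
   columns of larger rank, which O maps to 0 in the coordinates of rank at most [s i]. *)
Let G2_eq0 i k : (s k <= s i)%N -> forall t, G2 k i t = 0.
Proof.
have [n] := ubnP ((\max_j s j) - s i); elim: n i k => // n IH i k; rewrite ltnS => sn ki t.
pose x : 'rV[R]_p := const_mx t.
have -> : G2 k i t = \sum_j G1 k j t * plsem_coeff M x i j 0.
  have := congr1 (fun A : 'cV[R]_p => (O *m A) k 0) (plsem_jac_coeff wf rD x i).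
  rewrite /= mulmxA mxE => h.
  transitivity ((O *m \col_j plsem_col2 M j i (x 0 i)) k 0).
    by rewrite mxE; apply: eq_bigr => j _; rewrite !mxE.
  by rewrite -h; apply: eq_bigr => j _; rewrite G1E mxE.
rewrite big1// => j _; have [ij|ij] := boolP (s i < s j)%N; last by rewrite coeff0 ?mulr0.
have skj : (s k < s j)%N by exact: leq_ltn_trans ki ij.
suff -> : G1 k j t = 0 by rewrite mul0r.
have -> : G1 k j t = G1 k j 0.
  apply: is_derive_0_is_cst => u; rewrite -(IH j k _ (ltnW skj) u)//.
  apply: leq_trans sn; apply: ltn_sub2l => //.
  by apply: leq_trans ij _; exact: leq_bigmax.
by have := Otri skj; rewrite G1E mxE.
Qed.

Let G1_cst i k t : (s k <= s i)%N -> G1 k i t = G1 k i 0.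
Proof. by move=> ki; apply: is_derive_0_is_cst => u; rewrite -(G2_eq0 ki u). Qed.

(** The derivative is constant by [G1_cst] and vanishes at 0 by the choice of [O], so component [k]
    of the rotated map ignores later coordinates. *)
Let G_later i k t : (s k < s i)%N -> G k i t = G k i 0.
Proof.
move=> ki; apply: is_derive_0_is_cst => u.
by rewrite -(Otri ki) G1E mxE -(G1_cst u (ltnW ki)).
Qed.

Let G_diag k t : G k k t = G k k 0 + alpha k * t.
Proof.
pose h u : R := G k k u - alpha k * u.
suff : h t = h 0 by rewrite /h; lra.
apply: is_derive_0_is_cst => u; have dGu := dG k k u.
apply: (is_derive_ext (f := G k k - (alpha k \*: id))) => //.
by apply: is_derive_eq; rewrite (G1_cst u (leqnn _)) /GRing.scale /= mulr1 subrr.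
Qed.

(** Component [k] of the rotated map has slope [alpha k] in [x_k]; solving it for [x_k] gives this
    factor, and [m k l] is reserved for centring. *)
Definition rotated_fn (k l : 'I_p) (t : R) : R := - (alpha k)^-1 * (G k l t - m k l).

(** Edges with identically zero function are dropped, as well-formedness demands. The intercept
    collects the constant of the diagonal column, the constant later columns and the centring
    terms. *)
Definition rotated : plsem R p := PLSEM
  (fun l k => (s l < s k)%N && `[< exists t, rotated_fn k l t != 0 >])
  (fun k => - (alpha k)^-1 *
     (G k k 0 + \sum_(l | (s k < s l)%N) G k l 0 + \sum_(l | (s l < s k)%N) m k l))
  rotated_fn
  (fun k => (alpha k)^-1).

Lemma rotated_dag_lt l k : dag rotated l k -> (s l < s k)%N.
Proof. by move=> /andP[]. Qed.

Lemma rotated_wf : plsem_wf rotated.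
Proof.
split.
- exact: acyclic_of_rank rotated_dag_lt.
- by move=> k; rewrite /= invr_gt0.
- move=> l k /= /andP[_ /asboolP ne]; split=> //.
  have d1 t : is_derive t (1 : R) (rotated_fn k l) (- (alpha k)^-1 * G1 k l t).
    have dGt := dG k l t.
    apply: (is_derive_ext (f := - (alpha k)^-1 \*: (G k l - cst (m k l)))) => //.
    by apply: is_derive_eq; rewrite subr0.
  have d2 t : is_derive t (1 : R) (fun u => - (alpha k)^-1 * G1 k l u) (- (alpha k)^-1 * G2 k l t).
    have dGt := dG1 k l t.
    exact: (is_derive_ext (f := - (alpha k)^-1 \*: G1 k l)).
  have e1 : derive1 (rotated_fn k l) = fun u => - (alpha k)^-1 * G1 k l u.
    by apply/funext => t; rewrite derive1E; have [_ ->] := d1 t.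
  have e2 : derive1n 2 (rotated_fn k l) = fun u => - (alpha k)^-1 * G2 k l u.
    by rewrite /= e1; apply/funext => t; rewrite derive1E; have [_ ->] := d2 t.
  split; first by move=> t; have [] := d1 t.
  rewrite e1 e2; split; first by move=> t; have [] := d2 t.
  move=> t; apply: cvgM; first exact: cvg_cst.
  apply: (continuous_sum (F := fun j u => O k j * plsem_col2 M j l u)) => j u.
  apply: cvgM; first exact: cvg_cst.
  apply: cvgM; first exact: cvg_cst.
  apply: (@cvgN _ R^o).
  case: (boolP (dag M l j)) => Dlj; last exact: cvg_cst.
  have [[_ [_ c2]] _] := (let: And3 _ _ h := wf in h) _ _ Dlj.
  exact: c2.
Qed.

Lemma rotated_funE x k :
  plsem_fun rotated x 0 k = \sum_j O k j * plsem_fun M x 0 j.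
Proof.
have -> : \sum_j O k j * plsem_fun M x 0 j = \sum_i G k i (x 0 i).
  rewrite plsem_funE; under eq_bigr do rewrite mxE mulr_sumr.
  by rewrite exchange_big.
rewrite mxE /= invrK.
(* The dropped edges carry zero functions, so the sum may run over all earlier vertices. *)
have -> : \sum_(i | (s i < s k)%N && `[< exists t, rotated_fn k i t != 0 >])
    rotated_fn k i (x 0 i) = \sum_(i | (s i < s k)%N) rotated_fn k i (x 0 i).
  rewrite big_mkcondr; apply: eq_bigr => i _; case: asboolP => // ne.
  by apply/esym/eqP; apply: contra_notT ne => h; exists (x 0 i).
rewrite [RHS](bigD1 k)//= [X in _ = _ + X](bigID (fun i => (s k < s i)%N))/=.
rewrite [X in _ = _ + (X + _)](eq_bigl (fun i => s k < s i)%N); last first.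
  by move=> i; have [->|] := eqVneq i k; rewrite ?ltnn ?andbT.
rewrite [X in _ = _ + (_ + X)](eq_bigl (fun i => s i < s k)%N); last first.
  move=> i; rewrite -leqNgt leq_eqVlt; have [->|ik] := eqVneq i k; first by rewrite ltnn.
  by case: eqP => // /sinj /eqP; rewrite (negbTE ik).
rewrite [X in _ = _ + (X + _)](eq_bigr (fun i => G k i 0)); last first.
  by move=> i; exact: G_later.
rewrite [G k k (x 0 k)]G_diag /rotated_fn -mulr_sumr sumrB.
field; exact: lt0r_neq0.
Qed.

Lemma rotated_sqnorm x : sqnorm rotated x = sqnorm M x.
Proof.
pose v := (plsem_fun M x)^T.
have -> : sqnorm rotated x = ((O *m v)^T *m (O *m v)) 0 0.
  rewrite mxE; apply: eq_bigr => k _; rewrite rotated_funE mxE -expr2.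
  by congr (_ ^+ 2); rewrite mxE; apply: eq_bigr => j _; rewrite [X in _ = _ * X]mxE.
rewrite trmx_mul mulmxA -(mulmxA v^T) OO mulmx1 mxE.
by apply: eq_bigr => k _; rewrite trmxK [X in _ * X]mxE expr2.
Qed.

End Rotation.

(** * The rotated PLSEM generates the same law *)

Section RotatedGenerates.
Context {R : realType} {p : nat}.
Variable P : probability (p.-tuple R) R.

(** Equal squared norms make the density of [P] a constant multiple [k] of the one belonging to [N],
    so the innovations of [N] have the product law up to that factor. *)
Lemma sqnorm_innovation_law (M N : plsem R p) (s : 'I_p -> nat) :
  generates P M -> plsem_wf N -> injective s ->
  (forall i j, dag N i j -> (s i < s j)%N) ->
  (forall x, sqnorm N x = sqnorm M x) ->
  forall B : 'I_p -> set R, (forall j, measurable (B j)) ->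
  P (triangular (innovation_shift N) @^-1` box B) =
  (\prod_(j < p) normal_prob 0 (sd N j) (B j))%E.
Proof.
move=> gM wfN sinj sN sq.
have C0 := gauss_const_gt0 gM.1; have C0' := gauss_const_gt0 wfN.
pose k := gauss_const M / gauss_const N.
have [mE _ volE] := innovation_volume wfN sN sinj.
have lawk (B : 'I_p -> set R) : (forall j, measurable (B j)) ->
    P (triangular (innovation_shift N) @^-1` box B) =
    (k%:E * \prod_(j < p) normal_prob 0 (sd N j) (B j))%E.
  move=> mB; have mbB := measurable_box mB.
  have mEB : measurable (triangular (innovation_shift N) @^-1` box B).
    by rewrite -[X in measurable X]setTI; exact: mE.
  rewrite (generates_density gM mEB).
  transitivity (\int[tuple_leb p]_(x in triangular (innovation_shift N) @^-1` box B)
      (k%:E * (gauss_density (sd N) (triangular (innovation_shift N) x))%:E))%E.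
    apply: eq_integral => x _; rewrite gauss_density_innovation// -EFinM sq /k.
    by congr EFin; field; exact: lt0r_neq0.
  rewrite ge0_integralZl_EFin//.
  - rewrite ge0_integral_comp_volume//.
    + by rewrite integral_gauss_density_box.
    + exact: measurable_gauss_density.
    + exact: gauss_density_ge0.
  - by move=> x _; rewrite lee_fin gauss_density_ge0.
  - apply: measurable_funTS; apply/measurable_EFinP.
    exact: (measurableT_comp (measurable_gauss_density (sd N)) mE).
  - by rewrite /k divr_ge0// ltW.
(* Both sides have total mass 1 on the box whose sides are the whole line. *)
have k1 : k = 1.
  have := lawk (fun=> setT) (fun=> measurableT).
  rewrite big1; last by move=> j _; exact: probability_setT.
  rewrite mule1 (_ : _ @^-1` _ = setT) ?probability_setT; first by case.
  by apply/seteqP; split.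
by move=> B mB; rewrite lawk// k1 mul1e.
Qed.

(** The probability space and the variables [X] are kept; the new noise is defined as the
    innovations of the rotated PLSEM. Integrability of [X] is established first, because the new
    functions must be centred. *)
Lemma generates_of_order (M : plsem R p) (s : 'I_p -> nat) :
  generates P M -> injective s ->
  (forall i j, Vset M (i, j) -> (s i < s j)%N) ->
  exists2 N, generates P N & forall i j, dag N i j -> (s i < s j)%N.
Proof.
move=> gM sinj sV; have [wf [d [U [Q [X [eps [[meps mX] ind law [eqX fint] PX]]]]]]] := gM.
have [acD sd0 _] := wf; have [r rinj rD] := acyclic_rank acD.
have [A [OO Otri Opos]] := orthogonal_triangularisation sinj (plsem_jac_unit wf rD 0).
pose int (f : U -> R) := Q.-integrable setT (EFin \o f).
have intD f g : int f -> int g -> int (fun w => f w + g w) by exact: integrableD.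
have intZ c f : int f -> int (fun w => c * f w) by exact: integrableZl.
have intC c : int (fun=> c) by exact: finite_measure_integrable_cst.
have intS (F : 'I_p -> U -> R) (D : pred 'I_p) :
    (forall i, D i -> int (F i)) -> int (fun w => \sum_(i | D i) F i w).
  move=> h; rewrite /int (_ : _ \o _ = fun w => (\sum_(i | D i) (F i w)%:E)%E).
    exact: integrable_sum.
  by apply/funext => w; rewrite /= sumEFin.
have intX l : int (X l).
  rewrite (_ : X l = fun w => mu M l + \sum_(i | dag M i l) fn M l i (X i w) + eps l w).
    apply: (intD _ _); last exact: normal_integrable (meps l) (sd0 l) (law l).
    by apply: (intD _ _) => //; apply: intS => i Dil; case: (fint _ _ Dil).
  by apply/funext => w; exact: eqX.
have intG k l : int (fun w => mix A (plsem_col M) k l (X l w)).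
  apply: intS => j _; do 2 apply: (intZ _ _).
  apply: (intD (fun w => if l == j then X l w - mu M j else 0)
    (fun w => - (if dag M l j then fn M j l (X l w) else 0))).
    by case: eqP => _ //; exact: (intD _ _).
  case: (boolP (dag M l j)) => [/fint[h _]|_]; last by rewrite oppr0.
  rewrite (_ : (fun w => _) = fun w => -1 * fn M j l (X l w)); first exact: intZ.
  by apply/funext => w; rewrite mulN1r.
(* Subtracting the mean of each rotated curve at [X l] gives the new functions expectation zero. *)
pose m k l := fine (\int[Q]_w (mix A (plsem_col M) k l (X l w))%:E)%E.
pose N := rotated M s A m.
have wfN : plsem_wf N := rotated_wf s m wf Opos.
have sN : forall i j, dag N i j -> (s i < s j)%N by move=> i j; exact: rotated_dag_lt.
have sqN x : sqnorm N x = sqnorm M x := rotated_sqnorm m wf rD sinj sV OO Otri Opos x.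
have [mE _ _] := innovation_volume wfN sN sinj.
have mXt : measurable_fun setT (fun w => [tuple X i w | i < p]).
  apply/measurable_fun_tnthP => i; rewrite (_ : _ \o _ = X i)//.
  by apply/funext => w; rewrite /= tnth_mktuple.
pose eps' j w := tnth (triangular (innovation_shift N) [tuple X i w | i < p]) j.
have lawJ (J : {set 'I_p}) (B : 'I_p -> set R) : (forall j, measurable (B j)) ->
    Q (\bigcap_(j in [set j | j \in J]) (eps' j @^-1` B j)) =
    (\big[*%E/1%E]_(j in J) normal_prob 0 (sd N j) (B j))%E.
  (* Padding with the whole line outside [J] reduces a subfamily to a full box, each added factor
     being 1. *)
  move=> mB; pose B' j := if j \in J then B j else setT.
  have mB' j : measurable (B' j) by rewrite /B'; case: ifP.
  have mEB : measurable (triangular (innovation_shift N) @^-1` box B').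
    by rewrite -[X in measurable X]setTI; apply: mE => //; exact: measurable_box.
  transitivity (P (triangular (innovation_shift N) @^-1` box B')).
    rewrite -PX//; congr (Q _); apply/seteqP; split => w /= h j.
      by rewrite /B'; case: ifP => // jJ; exact: h.
    by move=> jJ; have := h j; rewrite /B' jJ.
  rewrite (sqnorm_innovation_law gM wfN sinj sN sqN mB') [RHS]big_mkcond.
  apply: eq_bigr => j _; rewrite /B'; case: ifP => // _.
  exact: probability_setT.
have law1 j (B : set R) : measurable B -> Q (eps' j @^-1` B) = normal_prob 0 (sd N j) B.
  move=> mB; have := lawJ [set j]%SET (fun=> B) (fun=> mB).
  rewrite big_set1 => <-; congr (Q _); apply/seteqP; split => w /= h.
    by move=> i /=; rewrite finset.inE => /eqP ->.
  by apply: h; rewrite /= finset.inE.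
exists N => //; split=> //; exists d, U, Q, X, eps'; split=> //.
- split=> // j.
  exact: (measurableT_comp (measurableT_comp (measurable_tnth j) mE) mXt).
- move=> J B mB; rewrite lawJ//; apply: eq_bigr => j _; exact/esym/law1.
- split.
    move=> j w; rewrite /eps' tnth_mktuple tnth_mktuple /innovation_shift.
    by under [X in _ = _ + (_ + (_ - X))]eq_bigr do rewrite tnth_mktuple; ring.
  move=> l k Dlk.
  pose c := - (mix A (plsem_col1 M) k k 0)^-1.
  pose h w := mix A (plsem_col M) k l (X l w) - m k l.
  have fnE : (fun w => (fn N k l (X l w))%:E) = (fun w => c%:E * (EFin \o h) w)%E by [].
  have i0 : int h by exact: (intD _ _).
  split; first by rewrite fnE; exact: integrableZl.
  rewrite fnE integralZl//.
  rewrite (integralB_EFin _ (intG k l) (intC (m k l)))//.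
  rewrite integral_cst//= probability_setT mule1 /m fineK.
    by rewrite subee ?mule0//; exact: integrable_fin_num (intG k l).
  exact: integrable_fin_num (intG k l).
Qed.

End RotatedGenerates.

Theorem mainTheorem4 (R : realType) (p : nat) (P : probability (p.-tuple R) R)
    (M : plsem R p) :
  generates P M ->
  Sset P = [set s : {perm 'I_p} | forall i j, Vset M (i, j) -> (s i < s j)%N].
Proof.
move=> gM; apply/seteqP; split => s /=.
  move=> [N [gN sN]] i j.
  exact: (generates_Vset_lt (s := fun i => s i) gM gN sN).
move=> sV; have [|N gN sN] := generates_of_order (s := fun i => s i) gM _ sV.
  by move=> i j /val_inj /perm_inj.
by exists N.
Qed.
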